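(* Let $p$ be an odd prime and let $i\in\{1,2,3\}$. Then $$|\mathrm{Aut}(G_{i,1}(\mathbb{F}_p))| = \gcd\!\left(p-1,\lceil 4/i\rceil\right)\cdot|\mathrm{GL}_2(\mathbb{F}_p)|\cdot p^{18}\cdot |E_1[3](\mathbb{F}_p)|,$$ where $E_1$ is the elliptic curve $y^2=x^3-x$ and $E_1[3](\mathbb{F}_p)$ is the group of its $\mathbb{F}_p$-rational points $P$ with $3P=O$ (including the point at infinity $O$).
   Context: Construction: for a field $K$ and a symmetric $3\times 3$ matrix $B(\mathbf y)=\sum_{\kappa=1}^3 B^{(\kappa)}y_\kappa$ of linear forms in $y_1,y_2,y_3$ (each $B^{(\kappa)}\in \mathrm{Mat}_3(K)$ symmetric), let $\phi:K^3\times K^3\to K^3$ be the bilinear map with $\kappa$-th coordinate $\phi(u,w)_\kappa=uB^{(\kappa)}w^{\mathrm T}$ ($u,w$ row vectors). The group $G_B(K)$ is the set $K^3\times K^3\times K^3$ with multiplication $(u,w,t)\star(u',w',t')=(u+u',w+w',t+t'+\phi(u,w'))$. The groups $G_{i,1}(\mathbb{F}_p)=G_{B_{i,1}}(\mathbb{F}_p)$ are defined by the matrices $B_{1,1}=\begin{pmatrix} y_3&-y_2&y_1\\ -y_2&-y_1&0\\ y_1&0&y_3\end{pmatrix}$, $B_{2,1}=\begin{pmatrix} 3y_1+y_3&-y_2&y_1-y_3\\ -y_2&-y_1-y_3&-y_2\\ y_1-y_3&-y_2&-y_1+y_3\end{pmatrix}$, $B_{3,1}=\begin{pmatrix} -3y_1+y_3&-y_2&y_1+y_3\\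 -y_2&-y_1+y_3&y_2\\ y_1+y_3&y_2&y_1+y_3\end{pmatrix}$. These are groups of order $p^9$, exponent $p$ and nilpotency class 2; $\mathrm{Aut}$ denotes the automorphism group of the abstract group. *)

(* Defs.v *)
From HB Require Import structures.
From mathcomp Require Import all_boot all_order all_fingroup all_algebra.
Set Implicit Arguments. Unset Strict Implicit. Unset Printing Implicit Defensive.
Import GRing.Theory.
Local Open Scope ring_scope.

Definition mx3 (R : nzRingType) (rows : seq (seq R)) : 'M[R]_3 :=
  \matrix_(a < 3, b < 3) nth 0 (nth [::] rows a) b.

Definition B11 (R : nzRingType) (y : 'rV[R]_3) : 'M[R]_3 :=
  let y1 := y 0 0 in let y2 := y 0 1 in let y3 := y 0 2 in
  mx3 [:: [:: y3; - y2; y1];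
          [:: - y2; - y1; 0];
          [:: y1; 0; y3]].

Definition B21 (R : nzRingType) (y : 'rV[R]_3) : 'M[R]_3 :=
  let y1 := y 0 0 in let y2 := y 0 1 in let y3 := y 0 2 in
  mx3 [:: [:: 3 * y1 + y3; - y2; y1 - y3];
          [:: - y2; - y1 - y3; - y2];
          [:: y1 - y3; - y2; - y1 + y3]].

Definition B31 (R : nzRingType) (y : 'rV[R]_3) : 'M[R]_3 :=
  let y1 := y 0 0 in let y2 := y 0 1 in let y3 := y 0 2 in
  mx3 [:: [:: - 3 * y1 + y3; - y2; y1 + y3];
          [:: - y2; - y1 + y3; y2];
          [:: y1 + y3; y2; y1 + y3]].

(* B_{i,1} for i = 1,2,3 (the value for other i is irrelevant). *)
Definition Bi1 (i : nat) (R : nzRingType) : 'rV[R]_3 -> 'M[R]_3 :=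
  match i with 2 => @B21 R | 3 => @B31 R | _ => @B11 R end.

(* coefficient matrix B^(kappa) of y_kappa in B(y) *)
Definition Bcoef (R : nzRingType) (B : 'rV[R]_3 -> 'M[R]_3) (k : 'I_3)
  : 'M[R]_3 := B (delta_mx 0 k).

Definition phiB (R : nzRingType) (B : 'rV[R]_3 -> 'M[R]_3)
  (u w : 'rV[R]_3) : 'rV[R]_3 :=
  \row_k (u *m Bcoef B k *m w^T) 0 0.

Lemma phiBDl (R : nzRingType) B (u u' w : 'rV[R]_3) :
  phiB B (u + u') w = phiB B u w + phiB B u' w.
Proof. by apply/rowP => k; rewrite [in LHS]mxE !mulmxDl !mxE. Qed.

Lemma phiBDr (R : nzRingType) B (u w w' : 'rV[R]_3) :
  phiB B u (w + w') = phiB B u w + phiB B u w'.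
Proof. by apply/rowP => k; rewrite [in LHS]mxE linearD /= mulmxDr !mxE. Qed.

Lemma phiB0l (R : nzRingType) B (w : 'rV[R]_3) : phiB B 0 w = 0.
Proof. by apply/rowP => k; rewrite [in LHS]mxE !mul0mx !mxE. Qed.

Lemma phiBNl (R : nzRingType) B (u w : 'rV[R]_3) :
  phiB B (- u) w = - phiB B u w.
Proof.
by apply/eqP; rewrite -subr_eq0 opprK -phiBDl addNr phiB0l.
Qed.

Definition gmul (R : nzRingType) (B : 'rV[R]_3 -> 'M[R]_3)
  (x y : 'rV[R]_3 * 'rV[R]_3 * 'rV[R]_3) : 'rV[R]_3 * 'rV[R]_3 * 'rV[R]_3 :=
  (x.1.1 + y.1.1, x.1.2 + y.1.2, x.2 + y.2 + phiB B x.1.1 y.1.2).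

Definition gone (R : nzRingType) : 'rV[R]_3 * 'rV[R]_3 * 'rV[R]_3 := (0, 0, 0).

Definition ginv (R : nzRingType) (B : 'rV[R]_3 -> 'M[R]_3)
  (x : 'rV[R]_3 * 'rV[R]_3 * 'rV[R]_3) : 'rV[R]_3 * 'rV[R]_3 * 'rV[R]_3 :=
  (- x.1.1, - x.1.2, - x.2 + phiB B x.1.1 x.1.2).

Lemma gmulA (R : nzRingType) (B : 'rV[R]_3 -> 'M[R]_3) : associative (gmul B).
Proof.
move=> [[u w] t] [[u' w'] t'] [[u'' w''] t''].
rewrite /gmul /= !addrA phiBDr phiBDl; congr (_, _, _).
rewrite -!addrA; do 2 congr (_ + _).
by rewrite [RHS]addrCA; congr (_ + _); rewrite addrC -addrA.
Qed.

Lemma gmul1 (R : nzRingType) (B : 'rV[R]_3 -> 'M[R]_3) :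
  left_id (@gone R) (gmul B).
Proof.
by move=> [[u w] t]; rewrite /gmul /= !add0r phiB0l addr0.
Qed.

Lemma gmulV (R : nzRingType) (B : 'rV[R]_3 -> 'M[R]_3) :
  left_inverse (@gone R) (ginv B) (gmul B).
Proof.
move=> [[u w] t]; rewrite /gmul /ginv /= !addNr phiBNl.
by rewrite [- t + _]addrC subrK subrr.
Qed.

Definition GB_car (p i : nat) : Type :=
  ('rV['F_p]_3 * 'rV['F_p]_3 * 'rV['F_p]_3)%type.

HB.instance Definition _ p i := Finite.on (GB_car p i).

Definition GB_mul p i : GB_car p i -> GB_car p i -> GB_car p i :=
  gmul (@Bi1 i 'F_p).
Definition GB_one p i : GB_car p i := @gone 'F_p.
Definition GB_inv p i : GB_car p i -> GB_car p i := ginv (@Bi1 i 'F_p).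

Lemma GB_mulA p i : associative (@GB_mul p i).
Proof. exact: gmulA. Qed.
Lemma GB_mul1 p i : left_id (@GB_one p i) (@GB_mul p i).
Proof. exact: gmul1. Qed.
Lemma GB_mulV p i : left_inverse (@GB_one p i) (@GB_inv p i) (@GB_mul p i).
Proof. exact: gmulV. Qed.

HB.instance Definition _ p i :=
  Finite_isGroup.Build (GB_car p i) (@GB_mulA p i) (@GB_mul1 p i) (@GB_mulV p i).

Definition G_i1 (p i : nat) : finGroupType := GB_car p i.

(* The elliptic curve E_1 : y^2 = x^3 - x over F_p, with the usual    *)
(* chord-tangent group law; None is the point at infinity O.          *)
Definition E1_on (F : fieldType) (P : option (F * F)) : bool :=
  if P is Some (x, y) then y ^+ 2 == x ^+ 3 - x else true.

Definition E1_add (F : fieldType) (P Q : option (F * F)) : option (F * F) :=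
  match P, Q with
  | None, _ => Q
  | _, None => P
  | Some (x1, y1), Some (x2, y2) =>
    if (x1 == x2) && (y1 == - y2) then None
    else
      let l := if x1 == x2 then (3 * x1 ^+ 2 - 1) / (2 * y1)
               else (y2 - y1) / (x2 - x1) in
      let x3 := l ^+ 2 - x1 - x2 in
      Some (x3, l * (x1 - x3) - y1)
  end.

Definition E1_3 (p : nat) : {set option ('F_p * 'F_p)} :=
  [set P | E1_on P & E1_add P (E1_add P P) == None].

(* Main.v *)
(* An automorphism of G_B splits into a homomorphism from G/Z(G) to Z(G) and a
   pair (A, D) acting on G/Z(G) = K^2 (x) K^3 and on Z(G), compatible with the
   commutator, i.e. an isometry of the net of alternating forms J (x) B(y).  The
   adjoint algebra of this net is M_2(K) (x) 1 and A normalises it, so that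
   A = g (x) T with T B(y) T^t = B(y D).  Taking determinants, D is a projective
   automorphism of the cubic E_1.  It moves the flex O = (0 : 1 : 0) to another
   rational flex, that is, to a point of E_1[3]; conversely every point of E_1[3]
   is reached by an explicit translation matrix, which lifts to the net.  What
   remains is the stabiliser of O, made of automorphisms of (E_1, O): those that
   lift to the net are (x, y) |-> (x / z^2, y / z) with z^4 = 1, and z^2 = 1
   when i = 2, 3.  Hence (g, point, z) together with a homomorphism parametrise
   Aut(G) bijectively. *)
Require Import Defs.
From HB Require Import structures.
From mathcomp Require Import all_boot all_order all_fingroup all_algebra all_solvable
  all_field.
From mathcomp Require Import ring.
Set Implicit Arguments. Unset Strict Implicit. Unset Printing Implicit Defensive.
Import GRing.Theory.
Local Open Scope ring_scope.

(** * Explicit 3 x 3 matrices *)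

Lemma ord3P (P : 'I_3 -> Prop) : P 0 -> P 1 -> P 2 -> forall i, P i.
Proof.
move=> P0 P1 P2 [[|[|[|i]]] Hi] //.
- by rewrite (_ : Ordinal Hi = 0) //; apply: val_inj.
- by rewrite (_ : Ordinal Hi = 1) //; apply: val_inj.
- by rewrite (_ : Ordinal Hi = 2) //; apply: val_inj.
Qed.

Lemma sum3 (V : nmodType) (f : 'I_3 -> V) : \sum_i f i = f 0 + f 1 + f 2.
Proof.
rewrite !big_ord_recl big_ord0 addr0 addrA.
by congr (f _ + f _ + f _); apply: val_inj.
Qed.

Section Mx33.
Variable K : fieldType.
Implicit Types (A B : 'M[K]_3).

Definition mx33 (a b c d e f g h i : K) : 'M[K]_3 :=
  mx3 [:: [:: a; b; c]; [:: d; e; f]; [:: g; h; i]].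

Lemma mx33_eta A :
  A = mx33 (A 0 0) (A 0 1) (A 0 2) (A 1 0) (A 1 1) (A 1 2) (A 2 0) (A 2 1) (A 2 2).
Proof. by apply/matrixP; do 2 elim/ord3P; rewrite mxE. Qed.

Lemma mx33_inj a b c d e f g h i a' b' c' d' e' f' g' h' i' :
  mx33 a b c d e f g h i = mx33 a' b' c' d' e' f' g' h' i' ->
  [/\ a = a', b = b' & c = c'] /\ [/\ d = d', e = e' & f = f'] /\
  [/\ g = g', h = h' & i = i'].
Proof.
move/matrixP=> E.
have := (E 0 0, E 0 1, E 0 2, E 1 0, E 1 1, E 1 2, E 2 0, E 2 1, E 2 2).
rewrite !mxE /=; do 8 case; by do 9 (move=> ?).
Qed.

Lemma mx33_mul a b c d e f g h i a' b' c' d' e' f' g' h' i' :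
  mx33 a b c d e f g h i *m mx33 a' b' c' d' e' f' g' h' i' =
  mx33 (a * a' + b * d' + c * g') (a * b' + b * e' + c * h') (a * c' + b * f' + c * i')
       (d * a' + e * d' + f * g') (d * b' + e * e' + f * h') (d * c' + e * f' + f * i')
       (g * a' + h * d' + i * g') (g * b' + h * e' + i * h') (g * c' + h * f' + i * i').
Proof. by apply/matrixP; do 2 elim/ord3P; rewrite mxE sum3 !mxE. Qed.

Lemma mx33_tr a b c d e f g h i :
  (mx33 a b c d e f g h i)^T = mx33 a d g b e h c f i.
Proof. by apply/matrixP; do 2 elim/ord3P; rewrite !mxE. Qed.

Lemma mx33_scale x a b c d e f g h i :
  x *: mx33 a b c d e f g h i =
  mx33 (x * a) (x * b) (x * c) (x * d) (x * e) (x * f) (x * g) (x * h) (x * i).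
Proof. by apply/matrixP; do 2 elim/ord3P; rewrite !mxE. Qed.

Lemma mx33_scalar x : x%:M = mx33 x 0 0 0 x 0 0 0 x.
Proof. by apply/matrixP; do 2 elim/ord3P; rewrite !mxE ?mulr1n ?mulr0n. Qed.

Lemma det_mx33 a b c d e f g h i :
  \det (mx33 a b c d e f g h i) =
  a * (e * i - f * h) - b * (d * i - f * g) + c * (d * h - e * g).
Proof.
rewrite (expand_det_row _ 0) sum3 !mxE /= /cofactor.
rewrite !(expand_det_row _ 0) !big_ord_recl !big_ord0 /cofactor !mxE /= !det_mx11 !mxE
  /=.
rewrite !expr0 !exprS !expr0 /=; ring.
Qed.

Definition row3 (x y z : K) : 'rV[K]_3 := \row_(j < 3) nth 0 [:: x; y; z] j.

Lemma row3_eta (v : 'rV[K]_3) : v = row3 (v 0 0) (v 0 1) (v 0 2).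
Proof. by apply/rowP; elim/ord3P; rewrite mxE. Qed.

Lemma row3_inj x y z x' y' z' :
  row3 x y z = row3 x' y' z' -> [/\ x = x', y = y' & z = z'].
Proof.
move/rowP=> E; have := (E 0, E 1, E 2); rewrite !mxE /=.
by do 2 case; do 3 move=> ?.
Qed.

Lemma row3_scale c x y z : c *: row3 x y z = row3 (c * x) (c * y) (c * z).
Proof. by apply/rowP; elim/ord3P; rewrite !mxE. Qed.

Lemma row3_mul x y z a b c d e f g h i :
  row3 x y z *m mx33 a b c d e f g h i =
  row3 (x * a + y * d + z * g) (x * b + y * e + z * h) (x * c + y * f + z * i).
Proof. by apply/rowP; elim/ord3P; rewrite mxE sum3 !mxE. Qed.

End Mx33.

(** * The nets of symmetric matrices *)

Section Net.
Variable K : fieldType.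
Implicit Types (s t : K) (y : 'rV[K]_3) (T X Z : 'M[K]_3).

(* The values s = 0, 1, -1, i.e. the roots of s^3 = s, give B_{1,1}, B_{2,1}, B_{3,1}.
   The form u B(y) w^T is symmetric in all of u, w, y: it polarises 3 s F + H, where
   F = x^3 - x z^2 - y^2 z defines E_1 and H = 3 x^2 z - 3 x y^2 + z^3 is proportional
   to the Hessian determinant of F. *)
Definition net s y : 'M[K]_3 :=
  let x := y 0 0 in let v := y 0 1 in let z := y 0 2 in
  mx33 (3 * s * x + z) (- v) (x - s * z)
       (- v) (- x - s * z) (- (s * v))
       (x - s * z) (- (s * v)) (- (s * x) + z).

Definition netpar (i : nat) : K := match i with 2 => 1 | 3 => -1 | _ => 0 end.

Lemma netparX3 i : netpar i ^+ 3 = netpar i.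
Proof. by case: i => [|[|[|[|i]]]]; rewrite /netpar; ring. Qed.

Lemma Bi1_net i y : (1 <= i <= 3)%N -> @Bi1 i K y = net (netpar i) y.
Proof.
by case: i => [|[|[|[|i]]]] // _; rewrite /net /=; apply/matrixP;
  do 2 elim/ord3P; rewrite !mxE /=; ring.
Qed.

Lemma netE s x v z : net s (row3 x v z) =
  mx33 (3 * s * x + z) (- v) (x - s * z)
       (- v) (- x - s * z) (- (s * v))
       (x - s * z) (- (s * v)) (- (s * x) + z).
Proof. by rewrite /net !mxE. Qed.

Lemma net_linear s : linear (net s).
Proof.
move=> c y y'; rewrite (row3_eta y) (row3_eta y').
by apply/matrixP; do 2 elim/ord3P; rewrite !mxE /=; ring.
Qed.
HB.instance Definition _ s :=
  GRing.isLinear.Build K 'rV[K]_3 'M[K]_3 *:%R (net s) (net_linear s).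

Lemma net_sym s y : (net s y)^T = net s y.
Proof. by rewrite /net mx33_tr. Qed.

Definition cubic (x y z : K) := x ^+ 3 - x * z ^+ 2 - y ^+ 2 * z.

Definition cubicv y := cubic (y 0 0) (y 0 1) (y 0 2).

Lemma det_net s y : s ^+ 3 = s -> \det (net s y) = (1 + 3 * s ^+ 2) * cubicv y.
Proof. by move=> s3; rewrite /net det_mx33 /cubicv /cubic; ring: s3. Qed.

Hypothesis two_neq0 : (2 : K) != 0.

Lemma par_cases s : s ^+ 3 = s -> [\/ s = 0, s = 1 | s = -1].
Proof.
move=> s3; have /eqP : s * (s - 1) * (s + 1) = 0 by ring: s3.
rewrite !mulf_eq0 subr_eq0 addr_eq0 => /orP[/orP[]|] /eqP ->.
- exact: Or31.
- exact: Or32.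
- exact: Or33.
Qed.

Lemma half_eq0 n (x : K) : 2 ^+ n * x = 0 -> x = 0.
Proof. by move/eqP; rewrite mulf_eq0 expf_eq0 (negPf two_neq0) andbF => /eqP. Qed.

(* [apply: (lincomb e); ring] proves [p = q] from a linear combination [e : d = 0] of
   hypotheses, assembled with [lincombD] and [lincombM]. *)
Lemma lincomb (d p q : K) : d = 0 -> p - q = d -> p = q.
Proof. by move=> -> /subr0_eq. Qed.

Lemma lincombD (a b : K) : a = 0 -> b = 0 -> a + b = 0.
Proof. by move=> -> ->; rewrite addr0. Qed.

Lemma lincombM (c a : K) : a = 0 -> c * a = 0.
Proof. by move=> ->; rewrite mulr0. Qed.

Lemma eq_subr0 (a b : K) : a = b -> a - b = 0.
Proof. by move->; rewrite subrr. Qed.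

Lemma net_inj s : injective (net s).
Proof.
move=> y y' /eqP; rewrite -subr_eq0 -linearB => /eqP; set w := y - y' => Ew.
apply/eqP; rewrite -subr_eq0 -/w; apply/eqP; move: Ew.
rewrite /net (mx33_eta 0) !mxE.
case/mx33_inj=> [[e00 e01 e02]] [[_ e11 _]] [_ _ e22].
have w2 : w 0 2 = 0.
  by apply/(@half_eq0 2)/(lincomb (lincombD e00 (lincombM 3 e22))); ring.
have w0 : w 0 0 = 0.
  by apply/(@half_eq0 1)/(lincomb (lincombD e02 (lincombM (-1) e11))); ring.
have w1 : w 0 1 = 0 by apply: (lincomb (lincombM (-1) e01)); ring.
by apply/rowP; elim/ord3P; rewrite ?w0 ?w1 ?w2 mxE.
Qed.

Lemma one_add3_sqr_neq0 s : s ^+ 3 = s -> 1 + 3 * s ^+ 2 != 0.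
Proof.
have four : 2 * 2 != 0 :> K by rewrite mulf_neq0.
case/par_cases=> ->.
- by rewrite expr0n mulr0 addr0 oner_neq0.
- by rewrite (_ : _ + _ = 2 * 2) //; ring.
- by rewrite (_ : _ + _ = 2 * 2) //; ring.
Qed.

Lemma nine_sqr_sub1_neq0 s : s ^+ 3 = s -> 9 * s ^+ 2 - 1 != 0.
Proof.
have eight : 2 * 2 * 2 != 0 :> K by rewrite !mulf_neq0.
case/par_cases=> ->.
- by rewrite expr0n mulr0 sub0r oppr_eq0 oner_neq0.
- by rewrite (_ : _ - _ = 2 * 2 * 2) //; ring.
- by rewrite (_ : _ - _ = 2 * 2 * 2) //; ring.
Qed.

(** Serves twice: with t = s it computes the adjoint algebra, and with another t it shows that an
    invertible intertwiner cannot change the parameter of the net. *)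
Lemma net_intertwiner s t X Z : s ^+ 3 = s -> t ^+ 3 = t ->
  (forall y, X *m net s y = net t y *m Z) ->
  X = (X 1 1)%:M /\ s * X 1 1 = t * X 1 1.
Proof.
move=> s3 t3 E.
have := (E (row3 1 0 0), E (row3 0 1 0), E (row3 0 0 1)).
rewrite !netE (mx33_eta X) (mx33_eta Z) !mx33_mul mx33_scalar !mxE /=.
move: (X 0 0) (X 0 1) (X 0 2) (X 1 0) (X 1 1) (X 1 2) (X 2 0) (X 2 1) (X 2 2)
  => x00 x01 x02 x10 x11 x12 x20 x21 x22.
move: (Z 0 0) (Z 0 1) (Z 0 2) (Z 1 0) (Z 1 1) (Z 1 2) (Z 2 0) (Z 2 1) (Z 2 2)
  => z00 z01 z02 z10 z11 z12 z20 z21 z22 [[]].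
case/mx33_inj=> [[/eq_subr0 a00 /eq_subr0 a01 /eq_subr0 a02]]
  [[/eq_subr0 a10 /eq_subr0 a11 /eq_subr0 a12]
   [/eq_subr0 a20 /eq_subr0 a21 /eq_subr0 a22]].
case/mx33_inj=> [[/eq_subr0 b00 /eq_subr0 b01 /eq_subr0 b02]]
  [[/eq_subr0 b10 /eq_subr0 b11 /eq_subr0 b12]
   [/eq_subr0 b20 /eq_subr0 b21 /eq_subr0 b22]].
case/mx33_inj=> [[/eq_subr0 c00 /eq_subr0 c01 /eq_subr0 c02]]
  [[/eq_subr0 c10 /eq_subr0 c11 /eq_subr0 c12]
   [/eq_subr0 c20 /eq_subr0 c21 /eq_subr0 c22]].
(* Z is eliminated by comparing proportional rows of [net t] at the three unit vectors; for
   instance, row 1 at the first equals row 0 at the second. Once x12 is eliminated too, x01 and x10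
   satisfy a 2 x 2 system of determinant 1 - 9 s^2, which is 1 or -8. *)
have x01E : x01 = 0.
  pose e4 := lincombD a10 (lincombM (-1) b00).
  pose e5 := lincombD a12 (lincombM (-1) b02).
  pose e6 := lincombD e5 (lincombM s e4).
  pose est := lincombD (lincombD a12 (lincombM (-1) c10)) (lincombD (lincombM (-1) b02)
    (lincombM t b00)).
  pose e3 := lincombD (lincombD a10 (lincombM (-1) c12)) (lincombD (lincombM (-1) b00)
    (lincombM t b02)).
  apply: (mulfI (nine_sqr_sub1_neq0 s3)); rewrite mulr0.
  apply: (lincomb (lincombD (lincombM (4 * s) e6) (lincombM (- (1 + 3 * s ^+ 2))
    (lincombD e3 (lincombM (- s) est))))).
  by ring: s3.
have x10E : x10 = 0.
  apply: (mulfI (one_add3_sqr_neq0 s3)); rewrite mulr0.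
  apply: (lincomb (lincombD (lincombD a12 (lincombM (-1) b02)) (lincombM s (lincombD
    a10 (lincombM (-1) b00))))).
  by rewrite x01E; ring.
have x12E : x12 = 0.
  by apply: (lincomb (lincombD a10 (lincombM (-1) b00))); rewrite x01E x10E; ring.
have x21E : x21 = 0.
  by apply: (lincomb (lincombD (lincombM (-1) b20) (lincombM t b00))); rewrite x01E;
    ring.
have d1 : x00 + s * x02 - x11 = 0.
  by apply: (lincomb (lincombD (lincombM (-1) b01) a11)); ring.
have d2 : s * x11 - t * x11 = 0.
  by apply: (lincomb (lincombD (lincombM (-1) c11) (lincombM t a11))); ring.
have d3 : x20 + s * x22 - s * x11 = 0.
  by apply: (lincomb (lincombD (lincombD (lincombM (-1) b21) (lincombM t a11))
    (lincombM (-1) d2))); ring.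
have d4 : x00 - s * x02 - 3 * s * x20 - x22 = 0.
  by apply: (lincomb (lincombD c00 (lincombM (-1) a20))); ring.
have d5 : - s * x00 + x02 - x20 + s * x22 = 0.
  by apply: (lincomb (lincombD c02 (lincombM (-1) a22))); ring.
have f1 : 2 * x00 - x11 - 3 * s ^+ 2 * x11 + 3 * s ^+ 2 * x22 - x22 = 0.
  by apply: (lincomb (lincombD (lincombD d1 d4) (lincombM (3 * s) d3))); ring.
have f2 : (1 + s ^+ 2) * x00 - x11 + s ^+ 2 * x11 - 2 * s ^+ 2 * x22 = 0.
  by apply: (lincomb (lincombD (lincombD d1 (lincombM (- s) d5)) (lincombM (- s) d3)));
    ring.
have x22E : x22 = x11.
  apply/subr0_eq/(mulfI (nine_sqr_sub1_neq0 s3)); rewrite mulr0.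
  by apply: (lincomb (lincombD (lincombM (-2) f2) (lincombM (1 + s ^+ 2) f1))); ring:
    s3.
have x20E : x20 = 0 by apply: (lincomb d3); rewrite x22E; ring.
have x00E : x00 = x11.
  by apply/subr0_eq/(@half_eq0 1)/(lincomb f1); rewrite x22E; ring.
have x02E : x02 = 0 by apply: (lincomb d5); rewrite x22E x00E x20E; ring.
by rewrite x00E x01E x02E x10E x12E x20E x21E x22E; split=> //; apply: subr0_eq.
Qed.

End Net.

(** * Symmetries of the cubic and of the nets *)

Section Sym.
Variable K : fieldType.
Implicit Types (s t : K) (y : 'rV[K]_3) (T X Z : 'M[K]_3).
Hypothesis two_neq0 : (2 : K) != 0.

(* Up to scaling, the projective automorphisms of E_1 that fix O; [e] is nonzero only
   in characteristic 3, where E_1 has the extra automorphisms x |-> x + e. *)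
Definition stabmx (z e : K) : 'M[K]_3 := mx33 1 0 0 0 z 0 e 0 (z ^+ 2).

(* Translation by the 3-torsion point P = (a, b), in homogeneous coordinates, in
   terms of the slope l of the tangent at P: one has a = l^2 / 3, and the 3-division
   polynomial becomes l^8 - 18 l^4 - 27. *)
Definition transl (l : K) : 'M[K]_3 :=
  mx33 18 (9 * l - 3 * l ^+ 5) (18 * l ^+ 2)
       (6 * l ^+ 3) (3 * l ^+ 4 - 9) (18 * l)
       (l ^+ 6 - 9 * l ^+ 2) (15 * l ^+ 3 - l ^+ 7) (- 9 - 3 * l ^+ 4).

(** The stabiliser of O preserves the cubic but may move the parameter of the net, from s to e + z^2
    s; only the elements fixing s are symmetries of the net. *)
Lemma stabmx_net s z e y : z ^+ 4 = 1 -> 3 * e = 0 -> e ^+ 3 = e ->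
  stabmx z e *m net s (y *m stabmx z e) *m (stabmx z e)^T =
  z ^+ 2 *: net (e + z ^+ 2 * s) y.
Proof.
move=> z4 e3 ee; rewrite (row3_eta y) row3_mul !netE mx33_tr !mx33_mul mx33_scale.
move: (y 0 0) (y 0 1) (y 0 2) => a b c.
congr mx33; try by ring: z4 ee.
- by apply: (lincomb (lincombM (s * c - z ^+ 2 * a) e3)); ring: z4 ee.
- by apply: (lincomb (lincombM (s * a + s * c * e + c * z ^+ 2) e3)); ring: z4 ee.
- by apply: (lincomb (lincombM (s * a + s * c * e + c * z ^+ 2) e3)); ring: z4 ee.
- apply: (lincomb (lincombM (s * a * e + s * c * e ^+ 2 + c * z ^+ 2 * e + a * z ^+ 2 -
  s * c) e3)).
  by ring: z4 ee.
Qed.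

(** Translations by 3-torsion points preserve every member of the Hesse pencil spanned by F and H,
    which is why s is arbitrary and stays the same. *)
Lemma transl_net s l y : l ^+ 8 = 18 * l ^+ 4 + 27 ->
  transl l *m net s (y *m transl l) *m (transl l)^T =
  (- (6 ^+ 6 * (1 + l ^+ 4))) *: net s y.
Proof.
move=> l8; rewrite (row3_eta y) row3_mul !netE mx33_tr !mx33_mul mx33_scale.
move: (y 0 0) (y 0 1) (y 0 2) => a b c.
congr mx33; ring: l8.
Qed.

(** The inverse of the translation by P is the translation by -P, whose tangent has slope -l. *)
Lemma transl_opp l : l ^+ 8 = 18 * l ^+ 4 + 27 ->
  transl l *m transl (- l) = (2 * 6 ^+ 3 * (3 + l ^+ 4))%:M.
Proof. by move=> l8; rewrite mx33_mul mx33_scalar; congr mx33; ring: l8. Qed.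

Lemma net_sim_cubic s T D : s ^+ 3 = s -> T \in unitmx ->
    (forall y, T *m net s y *m T^T = net s (y *m D)) ->
  exists2 c, c != 0 & forall y, cubicv (y *m D) = c * cubicv y.
Proof.
move=> s3 uT E; exists (\det T ^+ 2).
  by rewrite expf_neq0 //; move: uT; rewrite unitmxE unitfE.
move=> y; apply: (mulfI (one_add3_sqr_neq0 two_neq0 s3)).
have := congr1 determinant (E y); rewrite !det_mulmx det_tr.
by rewrite !det_net // => <-; ring.
Qed.

Lemma net_sim_unit s T D : T \in unitmx ->
  (forall y, T *m net s y *m T^T = net s (y *m D)) -> D \in unitmx.
Proof.
move=> uT E; rewrite -row_free_unit; apply: inj_row_free => y yD0.
apply: (net_inj two_neq0 (s := s)); rewrite linear0.
have := E y; rewrite yD0 linear0 => /(congr1 (fun M => invmx T *m M *m invmx T^T)).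
by rewrite -!mulmxA mulmxV ?unitmx_tr // mulmx1 mulKmx // !mul0mx mulmx0.
Qed.

Definition slope (a b : K) := (3 * a ^+ 2 - 1) / (2 * b).

Definition flex (P : option (K * K)) :=
  E1_on P && (E1_add P (E1_add P P) == None).

(** 3P = O means 2P = -P. As 2P has abscissa l^2 - 2a, this amounts to l^2 = 3a. A point with b = 0
    has order 2, so it is excluded. *)
Lemma flexP a b : reflect
  [/\ b ^+ 2 = a ^+ 3 - a, b != 0 & slope a b ^+ 2 = 3 * a]
  (flex (Some (a, b))).
Proof.
rewrite /flex /= eqxx /=; case: (eqVneq b 0) => [->|b0].
  by rewrite oppr0 eqxx /= andbF; constructor; case.
have -> : (b == - b) = false.
  by rewrite -subr_eq0 opprK -mulr2n -mulr_natl mulf_eq0 (negPf two_neq0) (negPf b0).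
rewrite -/(slope a b) /=; set l := slope a b.
apply: (iffP andP) => [[/eqP ab]|[ab _ l2]].
  case: ifP => // /andP[/eqP a3 _] _; split=> //.
  by apply: (lincomb (lincombM (-1) (eq_subr0 a3))); ring.
split; first exact/eqP.
have -> : l ^+ 2 - a - a = a by rewrite l2; ring.
by rewrite subrr mulr0 sub0r opprK !eqxx.
Qed.

Lemma slopeE a b : b != 0 -> 2 * b * slope a b = 3 * a ^+ 2 - 1.
Proof. by move=> b0; rewrite mulrC divfK // mulf_neq0. Qed.

(** In characteristic 3 there is no affine flex: l^2 = 3a would give l = 0, against 2 b l = 3 a^2 -
    1 = -1. *)
Lemma flex_slope a b : flex (Some (a, b)) -> let l := slope a b in
  [/\ (3 : K) != 0, l != 0, l ^+ 2 = 3 * a, 2 * b * l = 3 * a ^+ 2 - 1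
   & l ^+ 8 = 18 * l ^+ 4 + 27].
Proof.
case/flexP=> ab b0 l2 l; have lE := slopeE a b0; rewrite -/l in l2 lE.
have l0 : l != 0.
  apply/eqP=> l0; move: l2 lE; rewrite l0 expr0n mulr0 /= => /esym a0.
  move/(congr1 (fun u => 3 * u)); rewrite mulr0.
  have -> : 3 * (3 * a ^+ 2 - 1) = 3 * a * (3 * a) - 3 by ring.
  rewrite a0 mul0r sub0r => /esym/eqP; rewrite oppr_eq0 => /eqP t0.
  have := slopeE a b0; rewrite t0 mul0r -/l l0 mulr0 sub0r => /esym/eqP.
  by rewrite oppr_eq0 oner_eq0.
have t0 : (3 : K) != 0.
  by apply: contra_neq l0 => t0; apply/eqP; rewrite -sqrf_eq0 l2 t0 mul0r.
split=> //; apply/subr0_eq/(mulfI (mulf_neq0 t0 t0)); rewrite mulr0.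
rewrite (_ : l ^+ 8 = (l ^+ 2) ^+ 4); last by ring.
rewrite (_ : l ^+ 4 = (l ^+ 2) ^+ 2); last by ring.
(* Squaring 2 b l = 3 a^2 - 1 and substituting b^2 = a^3 - a and l^2 = 3a gives the 3-division
   polynomial 3 a^4 - 6 a^2 - 1. *)
have : (2 * b * l) ^+ 2 - (3 * a ^+ 2 - 1) ^+ 2 = 0 by rewrite lE subrr.
rewrite (_ : (2 * b * l) ^+ 2 = 4 * (b ^+ 2) * l ^+ 2); last by ring.
rewrite ab l2 => h; apply: (lincomb (lincombM (27 * 9) h)); ring.
Qed.

Definition transl_pt (P : option (K * K)) : 'M[K]_3 :=
  if P is Some (a, b) then transl (slope a b) else 1%:M.

Definition hom_pt (P : option (K * K)) : 'rV[K]_3 :=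
  if P is Some (a, b) then row3 a b 1 else row3 0 1 0.

(** E is applied to all three arguments of the symmetric trilinear form u B(y) w^T, which is
    multiplied by c. *)
Definition similitude s (E : 'M[K]_3) (c : K) :=
  forall y, E *m net s (y *m E) *m E^T = c *: net s y.

Lemma transl_pt_similitude s P : flex P -> exists2 c, c != 0 &
  similitude s (transl_pt P) c.
Proof.
case: P => [[a b]|_]; last first.
  exists 1; first exact: oner_neq0.
  by move=> y; rewrite /= trmx1 !mulmx1 mul1mx scale1r.
case/flex_slope; rewrite /=; set l := slope a b => t0 l0 l2 lE l8.
exists (- (6 ^+ 6 * (1 + l ^+ 4))); last by move=> y; exact: transl_net.
have six : 6 != 0 :> K by rewrite (_ : 6 = 2 * 3) ?mulf_neq0 //; ring.
rewrite oppr_eq0 mulf_neq0 ?expf_neq0 //; apply/eqP=> l4.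
have {}l4 : l ^+ 4 = -1 by apply: (lincomb l4); ring.
(* With l^4 = -1 the relation [l8] reads 1 = 9. *)
have : 2 ^+ 3 * 1 = 0 :> K.
  apply: (lincomb (lincombM (-1) (eq_subr0 l8))).
  by ring: l4.
by move/(half_eq0 two_neq0)/eqP; rewrite oner_eq0.
Qed.

Lemma transl_pt_unit P : flex P -> transl_pt P \in unitmx.
Proof.
case: P => [[a b]|_]; last exact: unitmx1.
case/flex_slope; rewrite /=; set l := slope a b => t0 l0 l2 lE l8.
have six : 6 != 0 :> K by rewrite (_ : 6 = 2 * 3) ?mulf_neq0 //; ring.
suff k0 : 2 * 6 ^+ 3 * (3 + l ^+ 4) != 0.
  have := transl_opp l8 => /(congr1 (fun M => (2 * 6 ^+ 3 * (3 + l ^+ 4))^-1 *: M)).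
  by rewrite scale_scalar_mx mulVf // scalemxAr => /mulmx1_unit[].
rewrite !mulf_neq0 ?expf_neq0 //; apply/eqP=> l4.
have {}l4 : l ^+ 4 = -3 by apply: (lincomb l4); ring.
(* With l^4 = -3 the relation [l8] reads 9 = -27. *)
have /eqP : 6 ^+ 2 = 0 :> K.
  apply: (lincomb (eq_subr0 l8)).
  by ring: l4.
by rewrite expf_eq0 (negPf six).
Qed.

Lemma transl_pt_origin P : flex P ->
  exists2 m, m != 0 & row3 0 1 0 *m transl_pt P = m *: hom_pt P.
Proof.
case: P => [[a b]|_]; last first.
  by exists 1; rewrite ?oner_neq0 // mulmx1 scale1r.
case/flex_slope; rewrite /=; set l := slope a b => t0 l0 l2 lE l8.
exists (18 * l).
  have -> : 18 * l = 2 * (3 * (3 * l)) by ring.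
  exact: (mulf_neq0 two_neq0 (mulf_neq0 t0 (mulf_neq0 t0 l0))).
rewrite /transl row3_mul row3_scale; congr row3; last by ring.
  by apply: (lincomb (lincombM (6 * l) (eq_subr0 l2))); ring.
by apply: (lincomb (lincombD (lincombM (-9) (eq_subr0 lE)) (lincombM (3 * (l ^+ 2 + 3 *
  a)) (eq_subr0 l2)))); ring.
Qed.

Lemma hom_pt_inj P Q m m' : m != 0 -> m *: hom_pt P = m' *: hom_pt Q -> P = Q.
Proof.
move=> m0; case: P => [[a b]|]; case: Q => [[a' b']|] //=; rewrite !row3_scale;
  case/row3_inj; rewrite ?mulr0 ?mulr1.
- by move=> ea eb e; rewrite -e in ea eb; rewrite (mulfI m0 ea) (mulfI m0 eb).
- by move=> _ _ /eqP; rewrite (negPf m0).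
- move=> _ + e; rewrite -e mul0r => /eqP; by rewrite (negPf m0).
Qed.

(** On the tangent z = 0 at O the cubic restricts to x^3. Hence on the image line it restricts to c
    x^3, a triple zero at the image of O, which is therefore a flex. *)
Lemma cubic_sim_origin D c : D \in unitmx -> c != 0 ->
    (forall y, cubicv (y *m D) = c * cubicv y) ->
  exists P m, [/\ flex P, m != 0 & row3 0 1 0 *m D = m *: hom_pt P].
Proof.
move=> uD c0 E.
have {}E x v w : let u := row3 x v w *m D in cubic (u 0 0) (u 0 1) (u 0 2)
    = c * cubic x v w.
  by rewrite /= -/(cubicv _) E /cubicv !mxE.
move: uD E; rewrite (mx33_eta D).
move: (D 0 0) (D 0 1) (D 0 2) (D 1 0) (D 1 1) (D 1 2) (D 2 0) (D 2 1) (D 2 2).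
move=> a0 a1 a2 b0 b1 b2 c0' c1 c2 uD E.
have {}E x v : cubic (x * a0 + v * b0) (x * a1 + v * b1) (x * a2 + v * b2) = c * x ^+ 3.
  by have := E x v 0; rewrite /= row3_mul !mxE /= !mul0r !addr0 => ->; rewrite /cubic;
    ring.
rewrite row3_mul !mul0r !add0r !addr0 !mul1r.
have [b20|b20] := eqVneq b2 0.
  have b00 : b0 = 0.
    have h := E 0 1; rewrite b20 /cubic in h.
    have /eqP : b0 ^+ 3 = 0 by apply: (lincomb (eq_subr0 h)); ring.
    by rewrite expf_eq0 => /eqP.
  exists None, b1; rewrite row3_scale mulr0 mulr1 b00 b20; split=> //.
  apply: contraTneq uD => ->; rewrite b00 b20 unitmxE det_mx33 unitfE negbK.
  by apply/eqP; ring.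
pose a := b0 / b2; pose b := b1 / b2.
have b0E : b0 = b2 * a by rewrite mulrC divfK.
have b1E : b1 = b2 * b by rewrite mulrC divfK.
(* (v1, v2, 0) is the image of (1 : 0 : 0) minus a multiple of the image of O: the point at infinity
   of the tangent at (a, b), which thus has slope v2 / v1. *)
pose v1 := a0 - a2 * a; pose v2 := a1 - a2 * b.
have {}E x v : cubic (x * v1 + v * a) (x * v2 + v * b) v = c * x ^+ 3.
  rewrite -(E x (v / b2 - x * a2 / b2)) b0E b1E /v1 /v2; congr cubic; by field.
move: E; rewrite /cubic => E.
have ab : b ^+ 2 = a ^+ 3 - a.
  by apply: (lincomb (lincombM (-1) (eq_subr0 (E 0 1)))); ring.
have cE : v1 ^+ 3 = c by apply: (lincomb (eq_subr0 (E 1 0))); ring.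
have v10 : v1 != 0 by apply: contra_neq c0 => v10; rewrite -cE v10 expr0n.
(* The values at (1, 1) and (1, -1) separate the two middle coefficients of the binary cubic at the
   cost of dividing by 2 only. *)
have e1 : 3 * a ^+ 2 * v1 - v1 - 2 * b * v2 = 0.
  apply: (@half_eq0 _ two_neq0 1).
  apply: (lincomb (lincombD (lincombD (eq_subr0 (E 1 1)) (eq_subr0 (E 1 (-1))))
    (lincombM (-2) (eq_subr0 cE)))).
  by ring.
have e2 : 3 * a * v1 ^+ 2 - v2 ^+ 2 = 0.
  apply: (@half_eq0 _ two_neq0 1).
  apply: (lincomb (lincombD (lincombD (eq_subr0 (E 1 1)) (lincombM (-1) (eq_subr0 (E 1
    (-1))))) (lincombM 2 (eq_subr0 ab)))).
  by ring.
pose l := v2 / v1; have v2E : v2 = v1 * l by rewrite mulrC divfK.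
have lE : 2 * b * l = 3 * a ^+ 2 - 1.
  apply: (mulfI v10); apply: (lincomb (lincombM (-1) e1)); rewrite v2E; ring.
have l2 : l ^+ 2 = 3 * a.
  apply: (mulfI v10); apply: (mulfI v10); apply: (lincomb (lincombM (-1) e2)); rewrite
    v2E; ring.
exists (Some (a, b)), b2; split=> //; last by rewrite row3_scale b0E b1E mulr1.
suff bn0 : b != 0.
  apply/flexP; split=> //; rewrite (_ : slope a b = l) //.
  by apply: (mulfI (mulf_neq0 two_neq0 bn0)); rewrite slopeE.
(* With b = 0 both a^3 - a and its derivative would vanish at a, against the smoothness of E_1; the
   combination below gives 2 = 0. *)
apply/eqP=> bz; move: lE ab; rewrite bz mulr0 mul0r expr0n /= => h1 h2.
have : 2 ^+ 1 * 1 = 0 :> K.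
  apply: (lincomb (lincombD (lincombM (2 - 3 * a ^+ 2) (eq_subr0 h1)) (lincombM (9 * a)
    (eq_subr0 h2)))).
  by ring.
by move/(half_eq0 two_neq0)/eqP; rewrite oner_eq0.
Qed.

End Sym.

(** * Classification of the symmetries of the nets *)

Section Class.
Variable K : fieldType.
Implicit Types (s t : K) (y : 'rV[K]_3) (D T X Z : 'M[K]_3).
Hypothesis two_neq0 : (2 : K) != 0.

(* A ternary cubic form is determined by its values at the points with coordinates
   0, 1, -1, and only 2 has to be inverted: hence the argument is valid over F_3. *)
Lemma cubic_sim_stab D c m : c != 0 -> m != 0 ->
    (forall y, cubicv (y *m D) = c * cubicv y) ->
    row3 0 1 0 *m D = m *: row3 0 1 0 ->
  exists al z e, [/\ al != 0, D = al *: stabmx z e, z ^+ 4 = 1, 3 * e = 0 & e ^+ 3 = e].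
Proof.
move=> c0 m0 E; rewrite (mx33_eta D) row3_mul row3_scale => /row3_inj[].
rewrite !mul0r !add0r !addr0 !mul1r mulr0 mulr1 => b0 b1 b2.
have {}E x v w : cubic (x * D 0 0 + w * D 2 0) (x * D 0 1 + v * m + w * D 2 1)
    (x * D 0 2 + w * D 2 2) = c * cubic x v w.
  have := E (row3 x v w); rewrite (mx33_eta D) row3_mul b0 b1 b2.
  by rewrite /cubicv !mxE /= !mulr0 !addr0.
rewrite b0 b1 b2; move: E.
move: (D 0 0) (D 0 1) (D 0 2) (D 2 0) (D 2 1) (D 2 2) => {b0 b1 b2} a0 a1 a2 c0' c1 c2.
rewrite /cubic => E; pose F x v w := eq_subr0 (E x v w).
have a20 : a2 = 0.
  apply: (mulfI (expf_neq0 2 m0)); rewrite ?mulr0; apply: (@half_eq0 _ two_neq0 1).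
  by apply: (lincomb (lincombD (lincombD (lincombM (-1) (F 1 1 0)) (lincombM (-1) (F 1
    (-1) 0))) (lincombM 2 (F 1 0 0)))); ring.
have c2E : m ^+ 2 * c2 = c.
  apply/subr0_eq; rewrite ?mulr0; apply: (@half_eq0 _ two_neq0 1).
  apply: (lincomb (lincombD (lincombD (lincombM (-1) (F 0 1 1)) (lincombM (-1) (F 0
    (-1) 1))) (lincombM 2 (F 0 0 1)))).
  by ring.
have c20 : c2 != 0 by apply: contra_neq c0 => c20; rewrite -c2E c20 mulr0.
have mc20 : m * c2 != 0 by rewrite mulf_neq0.
have c10 : c1 = 0.
  apply: (mulfI mc20); rewrite ?mulr0; apply: (@half_eq0 _ two_neq0 2).
  by apply: (lincomb (lincombD (lincombM (-1) (F 0 1 1)) (F 0 (-1) 1))); ring.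
have a10 : a1 = 0.
  apply: (mulfI mc20); rewrite ?mulr0; apply: (@half_eq0 _ two_neq0 2).
  by apply: (lincomb (lincombD (lincombM (-1) (F 1 1 1)) (F 1 (-1) 1))); rewrite a20
    c10; ring.
have a0E : a0 ^+ 3 = c.
  by apply: (lincomb (F 1 0 0)); rewrite a10 a20; ring.
have a00 : a0 != 0 by apply: contra_neq c0 => a00; rewrite -a0E a00 expr0n.
have e1 : c0' ^+ 3 - c0' * c2 ^+ 2 = 0.
  by apply: (lincomb (F 0 0 1)); rewrite c10; ring.
have e2 : 3 * c0' = 0.
  apply: (mulfI (expf_neq0 2 a00)); rewrite ?mulr0; apply: (@half_eq0 _ two_neq0 1).
  apply: (lincomb (lincombD (lincombD (F 1 0 1) (lincombM (-1) (F 1 0 (-1)))) (lincombM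
    (-2) e1))).
  by rewrite a10 a20 c10; ring.
have e3 : a0 ^+ 2 = c2 ^+ 2.
  apply/subr0_eq/(mulfI a00); rewrite ?mulr0; apply: (@half_eq0 _ two_neq0 1).
  apply: (lincomb (lincombD (lincombD (F 1 0 1) (F 1 0 (-1))) (lincombM (-2 * a0 * c0')
    e2))).
  by rewrite a10 a20 c10; ring.
have e4 : m ^+ 2 * c2 = a0 ^+ 3 by rewrite c2E.
(* With z = m / a0, the relations m^2 c2 = a0^3 and a0^2 = c2^2 give z^4 = 1 and c2 = a0 z^2. *)
have z4 : (m / a0) ^+ 4 = 1.
  apply: (mulfI (mulf_neq0 (expf_neq0 4 a00) (expf_neq0 2 c20))).
  rewrite -[RHS](_ : (m ^+ 2 * c2) ^+ 2 = _); last by rewrite e4 -e3; ring.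
  by field.
exists a0, (m / a0), (c0' / a0); split=> //.
- rewrite mx33_scale a10 a20 c10; congr mx33; try (by field); rewrite ?mulr0 ?mulr1 //.
  apply: (mulfI (mulf_neq0 c20 a00)).
  rewrite -[LHS](_ : c2 ^+ 2 * a0 = _); last by ring.
  rewrite -e3 -[RHS](_ : m ^+ 2 * c2 = _); last by field.
  by rewrite e4; ring.
- by rewrite mulrA e2 mul0r.
- apply: (mulfI (expf_neq0 3 a00)).
  rewrite -[LHS](_ : c0' ^+ 3 = _); last by field.
  rewrite -[RHS](_ : c0' * a0 ^+ 2 = _); last by field.
  by rewrite e3; apply: subr0_eq.
Qed.

Lemma stabmx_unit (z e : K) : z ^+ 4 = 1 -> stabmx z e \in unitmx.
Proof.
move=> z4; rewrite unitmxE det_mx33 unitfE; apply/negP=> /eqP h.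
have /eqP : 1 = 0 :> K by apply: (lincomb (lincombM z h)); ring: z4.
by rewrite oner_eq0.
Qed.

(** Normal form of a symmetry: on row vectors, first an automorphism fixing O, then the translation
    taking O to P. *)
Definition sym_mx (P : option (K * K)) (z : K) := stabmx z 0 *m transl_pt P.

Lemma sym_mx_unit P (z : K) : flex P -> z ^+ 4 = 1 -> sym_mx P z \in unitmx.
Proof.
by move=> fP z4; rewrite unitmx_mul stabmx_unit // transl_pt_unit.
Qed.

Lemma sym_mx_similitude s P (z : K) : flex P -> z ^+ 4 = 1 -> z ^+ 2 * s = s ->
  exists2 c, c != 0 & similitude s (sym_mx P z) c.
Proof.
move=> fP z4 zs; have [c c0 h] := transl_pt_similitude two_neq0 s fP.
exists (c * z ^+ 2).
  rewrite mulf_neq0 ?expf_neq0 //; apply: contraTneq (oner_neq0 K) => z0.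
  by rewrite negbK -z4 z0 expr0n.
move=> y; transitivity (stabmx z 0 *m (transl_pt P *m net s ((y *m stabmx z 0) *m
  transl_pt P)
   *m (transl_pt P)^T) *m (stabmx z 0)^T); first by rewrite trmx_mul !mulmxA.
rewrite h -scalemxAr -scalemxAl stabmx_net ?mulr0 ?expr0n //.
by rewrite add0r zs scalerA.
Qed.

(* T is an inverse because [similitude s E c] has y E on the left: it makes the
   inverse of E act on the net as y |-> y E / c. *)
Lemma net_sim_class s T D : s ^+ 3 = s ->
    (3 = 0 :> K -> forall z : K, z ^+ 4 = 1 -> z ^+ 2 = 1) ->
    T \in unitmx -> (forall y, T *m net s y *m T^T = net s (y *m D)) ->
  exists P z l, [/\ flex P, z ^+ 4 = 1, z ^+ 2 * s = s, l != 0
                  & T = l *: invmx (sym_mx P z)].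
Proof.
move=> s3 sqr1 uT simT; have [c c0 cubD] := net_sim_cubic two_neq0 s3 uT simT.
have uD := net_sim_unit two_neq0 uT simT.
have [P [m [fP m0 OD]]] := cubic_sim_origin two_neq0 uD c0 cubD.
have uE := transl_pt_unit two_neq0 fP.
have [c1 c10 simE] := transl_pt_similitude two_neq0 s fP.
have [m1 m10 OE] := transl_pt_origin two_neq0 fP.
set E := transl_pt P in uE simE OE.
(* Composing with the translation replaces D by c1 D E^-1, which fixes O projectively. *)
have simT' y : (E *m T) *m net s y *m (E *m T)^T = net s (y *m (c1 *: (D *m invmx E))).
  transitivity (E *m (T *m net s y *m T^T) *m E^T); first by rewrite trmx_mul !mulmxA.
  rewrite simT -{1}(mulmxKV uE D) mulmxA simE -linearZ /=.
  by rewrite -scalemxAr.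
have uT' : E *m T \in unitmx by rewrite unitmx_mul uE.
have [c' c'0 cubD'] := net_sim_cubic two_neq0 s3 uT' simT'.
have OD' : row3 0 1 0 *m (c1 *: (D *m invmx E)) = (c1 * m / m1) *: row3 0 1 0.
  rewrite -scalemxAr mulmxA OD -scalemxAl -!scalerA; congr (_ *: (_ *: _)).
  have -> : hom_pt P = m1^-1 *: (row3 0 1 0 *m E) by rewrite OE scalerA mulVf //
    scale1r.
  by rewrite -scalemxAl mulmxK.
have m'0 : c1 * m / m1 != 0 by rewrite !mulf_neq0 ?invr_neq0.
have [al [z [e [al0 D'E z4 e3 ee]]]] := cubic_sim_stab c'0 m'0 cubD' OD'.
(* X acts on the net without moving y, up to a scalar and a change of parameter to e + z^2 s. It is
   thus an intertwiner, hence scalar, and the parameter cannot have changed. *)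
pose X := stabmx z e *m (E *m T).
have uX : X \in unitmx by rewrite unitmx_mul stabmx_unit.
have simX y : X *m net s y = net (e + z ^+ 2 * s) y *m ((al * z ^+ 2) *: invmx X^T).
  apply: (can_inj (mulmxK (_ : X^T \in unitmx))); first by rewrite unitmx_tr.
  rewrite -scalemxAr -scalemxAl mulmxKV ?unitmx_tr //.
  transitivity (stabmx z e *m (E *m T *m net s y *m (E *m T)^T) *m (stabmx z e)^T).
    by rewrite /X [in LHS]trmx_mul !mulmxA.
  rewrite simT' D'E -scalemxAr linearZ /= -scalemxAr -scalemxAl.
  by rewrite stabmx_net // scalerA.
have s''3 : (e + z ^+ 2 * s) ^+ 3 = e + z ^+ 2 * s.
  apply: (lincomb (lincombM (e * z ^+ 2 * s + z ^+ 4 * s ^+ 2) e3)); ring: z4 ee s3.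
have [XE sX] := net_intertwiner two_neq0 s3 s''3 simX.
have x0 : X 1 1 != 0.
  apply: contraTneq uX => x0; rewrite XE x0 unitmxE det_scalar expr0n /=.
  by rewrite unitr0.
have es : s = e + z ^+ 2 * s by apply: (mulIf x0).
(* In characteristic 3 one has z^2 = 1, so that s = e + s. *)
have e0 : e = 0.
  have [t0|t0] := eqVneq (3 : K) 0; last by apply: (mulfI t0); rewrite mulr0.
  by move: es; rewrite sqr1 // mul1r -{1}[s]add0r => /addIr.
exists P, z, (X 1 1); split=> //; first by rewrite {2}es e0 add0r.
have uS : sym_mx P z \in unitmx by rewrite sym_mx_unit.
apply: (can_inj (mulKmx uS)); rewrite -scalemxAr mulmxV // scalemx1 -XE.
by rewrite /X e0 /sym_mx mulmxA.
Qed.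

(** P is recovered as the image of O. After cancelling the translation, the diagonal entries 1 and z
    give l = 1 and z = z'. *)
Lemma sym_mx_inj P z P' z' l : flex P -> z ^+ 4 = 1 -> flex P' -> z' ^+ 4 = 1 ->
  sym_mx P z = l *: sym_mx P' z' -> P = P' /\ z = z'.
Proof.
move=> fP z4 fP' z'4 E.
have z0 : z != 0.
  apply: contraTneq (oner_neq0 K) => z0; by rewrite negbK -z4 z0 expr0n.
have OS w : row3 0 1 0 *m stabmx w 0 = w *: row3 0 1 0 :> 'rV[K]_3.
  by rewrite row3_mul row3_scale; congr row3; ring.
have [m m0 OP] := transl_pt_origin two_neq0 fP.
have [m' m'0 OP'] := transl_pt_origin two_neq0 fP'.
have PP' : P = P'.
  apply: (@hom_pt_inj K _ _ (z * m) (l * (z' * m'))); first by rewrite mulf_neq0.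
  have := congr1 (mulmx (row3 0 1 0)) E.
  by rewrite /sym_mx -scalemxAr !mulmxA !OS -!scalemxAl OP OP' !scalerA mulrA.
split=> //; move: E; rewrite -PP' /sym_mx scalemxAl.
move/(can_inj (mulmxK (transl_pt_unit two_neq0 fP))).
rewrite mx33_scale => /mx33_inj[[+ _ _] [[_ + _] _]].
by rewrite mulr1 => <-; rewrite mul1r.
Qed.

End Class.

(** * Isometries of the alternating net *)

Section Tensor.
Variable K : fieldType.
Implicit Types (s t : K) (y : 'rV[K]_3) (D T X Z : 'M[K]_3) (g : 'M[K]_2).
Hypothesis two_neq0 : (2 : K) != 0.

Definition tens g T : 'M[K]_(3 + 3) :=
  block_mx (g 0 0 *: T) (g 0 1 *: T) (g 1 0 *: T) (g 1 1 *: T).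

Definition altnet s y : 'M[K]_(3 + 3) := block_mx 0 (net s y) (- net s y) 0.

Lemma altnet_inj s : injective (altnet s).
Proof. by move=> y y' /eq_block_mx[_ /net_inj ->]. Qed.

Lemma det_mx2 g : \det g = g 0 0 * g 1 1 - g 0 1 * g 1 0.
Proof.
rewrite (expand_det_row _ 0) !big_ord_recl big_ord0 /cofactor !det_mx11 !mxE /=.
rewrite /bump /= !expr0 expr1 mul1r mulN1r addr0 mulrN.
by congr (_ * g _ _ - g _ _ * g _ _); apply: val_inj.
Qed.

(** For a 2 x 2 matrix, g J g^T = (det g) J. *)
Lemma altnet_tens s g T y :
  tens g T *m altnet s y *m (tens g T)^T =
  block_mx 0 (\det g *: (T *m net s y *m T^T)) (- (\det g *: (T *m net s y *m T^T))) 0.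
Proof.
rewrite tr_block_mx !mulmx_block !mulmx0 !add0r !addr0 !linearZ /= det_mx2.
rewrite !mulmxN -!scalemxAl !mulNmx -!scalemxAl; set N := T *m _ *m _.
rewrite !scalerN !scalerA -!scaleNr -!scalerDl -[0 in RHS](scale0r N).
by congr block_mx; congr (_ *: _); ring.
Qed.

Definition scal2 g : 'M[K]_(3 + 3) := tens g 1%:M.

(** The matrix on the right is the cofactor matrix of g tensored with 1; it is the adjoint for every
    y at once. *)
Lemma scal2_adjoint s g y : scal2 g *m altnet s y =
  altnet s y *m block_mx (g 1 1)%:M (- (g 1 0)%:M) (- (g 0 1)%:M) (g 0 0)%:M.
Proof.
rewrite /scal2 /tens !mulmx_block !mulmx0 !mul0mx !add0r !addr0 !scalemx1.
by rewrite !mulmxN !mulNmx !scalar_mxC opprK.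
Qed.

(** Each of the four 3 x 3 blocks of Y intertwines the net with itself, so it is scalar. *)
Lemma adjoint_scal2 s (Y Z : 'M[K]_(3 + 3)) : s ^+ 3 = s ->
  (forall y, Y *m altnet s y = altnet s y *m Z) -> exists g, Y = scal2 g.
Proof.
move=> s3; rewrite -(submxK Y) -(submxK Z).
move: (ulsubmx Y) (ursubmx Y) (dlsubmx Y) (drsubmx Y) => Ya Yb Yc Yd.
move: (ulsubmx Z) (ursubmx Z) (dlsubmx Z) (drsubmx Z) => Za Zb Zc Zd E.
have {}E y : [/\ Yb *m net s y = net s y *m - Zc, Ya *m net s y = net s y *m Zd,
    Yd *m net s y = net s y *m Za & Yc *m net s y = net s y *m - Zb].
  have := E y; rewrite /altnet !mulmx_block !mulmx0 !mul0mx !add0r !addr0.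
  case/eq_block_mx; rewrite !mulmxN !mulNmx => <- -> /oppr_inj -> ->.
  by rewrite !opprK.
have h (X W : 'M[K]_3) : (forall y, X *m net s y = net s y *m W) -> X = (X 1 1)%:M.
  by case/(net_intertwiner two_neq0 s3 s3).
exists (\matrix_(i, j) (if i == 0 then if j == 0 then Ya 1 1 else Yb 1 1
                        else if j == 0 then Yc 1 1 else Yd 1 1)).
rewrite /scal2 /tens !mxE /= !scalemx1.
by rewrite -(h Ya Zd) -?(h Yb (- Zc)) -?(h Yc (- Zb)) -?(h Yd Za) // => y; case: (E y).
Qed.

Lemma row_mx_tens (u w : 'rV[K]_3) g T : row_mx u w *m tens g T =
  row_mx ((g 0 0 *: u + g 1 0 *: w) *m T) ((g 0 1 *: u + g 1 1 *: w) *m T).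
Proof.
by rewrite mul_row_block !mulmxDl -!scalemxAl -!scalemxAr.
Qed.

Lemma proportional_mx (r r' : K) T X : (r, r') != (0, 0) ->
  r *: T + r' *: X = 0 -> exists b d (Y : 'M[K]_3), T = b *: Y /\ X = d *: Y.
Proof.
move=> rn0 E; have [r0|r0] := eqVneq r 0.
  move: rn0 E; rewrite r0 xpair_eqE eqxx /= scale0r add0r => r'0 /eqP.
  rewrite scaler_eq0 (negPf r'0) => /eqP X0.
  by exists 1, 0, T; rewrite scale1r scale0r.
exists (- (r^-1 * r')), 1, X; rewrite scale1r; split=> //.
apply: (scalerI r0); rewrite scalerA mulrN mulrA mulfV // mul1r scaleNr.
by apply/eqP; rewrite -addr_eq0 E.
Qed.

(* Conjugation by A preserves the adjoint algebra of the alternating net, which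
   is M_2(K) (x) 1; the images of two matrix units already force A to be a tensor. *)
Lemma altnet_isometry_tens s (A : 'M[K]_(3 + 3)) D : s ^+ 3 = s ->
    A \in unitmx -> (forall y, A *m altnet s y *m A^T = altnet s (y *m D)) ->
  exists g T, [/\ A = tens g T, g \in unitmx & T \in unitmx].
Proof.
move=> s3 uA isoA.
have uD : D \in unitmx.
  rewrite -row_free_unit; apply: inj_row_free => y yD0.
  apply: (altnet_inj (s := s)).
  have := isoA y; rewrite yD0 => /(congr1 (fun M => invmx A *m M *m invmx A^T)).
  rewrite !mulmxA mulVmx // mul1mx mulmxK ?unitmx_tr // => ->.
  by rewrite /altnet linear0 oppr0 block_mx0 mulmx0 mul0mx.
have adjA g : exists r, A *m scal2 g = scal2 r *m A.
  pose W := block_mx (g 1 1)%:M (- (g 1 0)%:M) (- (g 0 1)%:M) (g 0 0)%:M : 'M[K]_(3 +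
    3).
  have [|r rE] := @adjoint_scal2 s (A *m scal2 g *m invmx A) (invmx A^T *m W *m A^T) s3.
    move=> y; rewrite -(mulmxKV uD y) -isoA.
    set z := y *m invmx D; rewrite !mulmxA mulmxKV // mulmxK ?unitmx_tr //.
    by rewrite -[A *m scal2 g *m _]mulmxA (scal2_adjoint s g z) !mulmxA.
  by exists r; rewrite -rE mulmxKV.
move: uA adjA; rewrite -(submxK A).
move: (ulsubmx A) (ursubmx A) (dlsubmx A) (drsubmx A) => a b c d uA adjA.
have blk g : exists r : 'M[K]_2,
    [/\ g 0 0 *: a + g 1 0 *: b = r 0 0 *: a + r 0 1 *: c,
        g 0 1 *: a + g 1 1 *: b = r 0 0 *: b + r 0 1 *: d,
        g 0 0 *: c + g 1 0 *: d = r 1 0 *: a + r 1 1 *: c &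
        g 0 1 *: c + g 1 1 *: d = r 1 0 *: b + r 1 1 *: d].
  have [r H] := adjA g; exists r; move: H.
  rewrite /scal2 /tens !mulmx_block !scalemx1 !mul_mx_scalar !mul_scalar_mx.
  by case/eq_block_mx.
(* The first matrix unit gives linear relations between b and d, which make them proportional unless
   r = 0; but then a = c = 0 and A is singular. The second unit expresses a and c through b and
   d. *)
have [r [Ea Eb Ec Ed]] := blk (delta_mx 0 0).
have [q [_ Fb _ Fd]] := blk (delta_mx 0 1).
move: Ea Eb Ec Ed Fb Fd; rewrite !mxE /= !scale1r !scale0r !addr0.
move=> Ea Eb Ec Ed Fb Fd.
have [be [de [T [bE dE]]]] : exists be de (T : 'M[K]_3), b = be *: T /\ d = de *: T.
  have [r0|r0] := eqVneq (r 0 0, r 0 1) (0, 0); last exact: proportional_mx r0 (esym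
    Eb).
  have [r1|r1] := eqVneq (r 1 0, r 1 1) (0, 0); last exact: proportional_mx r1 (esym
    Ed).
  case: r0 r1 => r00 r01 [r10 r11].
  have a0 : a = 0 by rewrite Ea r00 r01 !scale0r addr0.
  have c0 : c = 0 by rewrite Ec r10 r11 !scale0r addr0.
  have : block_mx a b c d *m col_mx 1%:M 0 = 0.
    by rewrite mul_block_col !mulmx0 !mulmx1 !addr0 a0 c0 col_mx0.
  move/(congr1 (mulmx (invmx (block_mx a b c d)))); rewrite mulKmx // mulmx0.
  rewrite -(@col_mx0 _ 3 3) => /eq_col_mx[/eqP]; by rewrite (negPf (matrix_nonzero1 _
    _)).
pose g : 'M[K]_2 := \matrix_(i, j) (if i == 0
   then if j == 0 then q 0 0 * be + q 0 1 * de else be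
   else if j == 0 then q 1 0 * be + q 1 1 * de else de).
have AE : block_mx a b c d = tens g T.
  rewrite /tens !mxE /= -bE -dE Fb Fd bE dE !scalerA -!scalerDl.
  by [].
exists g, T; split=> //.
(* A kernel vector v of g yields the kernel vector v (x) u of A. *)
- rewrite -row_free_unit; apply: inj_row_free => v vg0.
  pose u : 'rV[K]_3 := const_mx 1.
  have u0 : u != 0 by apply/eqP=> /rowP/(_ 0); rewrite !mxE => /eqP; rewrite oner_eq0.
  have : row_mx (v 0 0 *: u) (v 0 1 *: u) *m block_mx a b c d = 0.
    rewrite AE row_mx_tens !scalerA -!scalerDl.
    have e j : g 0 j * v 0 0 + g 1 j * v 0 1 = (v *m g) 0 j.
      rewrite [RHS]mxE !big_ord_recl big_ord0 addr0 ![g _ j * _]mulrC.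
      by congr (v _ _ * g _ _ + v _ _ * g _ _); apply: val_inj.
    by rewrite !e vg0 !mxE scale0r mul0mx row_mx0.
  move/(congr1 (mulmx^~ (invmx (block_mx a b c d)))); rewrite mulmxK // mul0mx.
  rewrite -row_mx0 => /eq_row_mx[/eqP + /eqP]; rewrite !scaler_eq0 (negPf u0) !orbF.
  move=> /eqP v0 /eqP v1; apply/rowP=> -[[|[|k]] Hk] //; rewrite mxE.
  - by rewrite -[RHS]v0; congr (v _ _); apply: val_inj.
  - by rewrite -[RHS]v1; congr (v _ _); apply: val_inj.
- rewrite -row_free_unit; apply: inj_row_free => v vT0.
  have : row_mx v 0 *m block_mx a b c d = 0.
    by rewrite AE row_mx_tens !scaler0 !addr0 -!scalemxAl vT0 !scaler0 row_mx0.
  move/(congr1 (mulmx^~ (invmx (block_mx a b c d)))); rewrite mulmxK // mul0mx.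
  by rewrite -row_mx0 => /eq_row_mx[].
Qed.

End Tensor.

(** * Automorphisms of the group *)

Section Aut.
Variables (K : fieldType) (s : K).
Hypotheses (two_neq0 : (2 : K) != 0) (s3 : s ^+ 3 = s).
Let T3 := ('rV[K]_3 * 'rV[K]_3 * 'rV[K]_3)%type.
Implicit Types (u w t : 'rV[K]_3) (z : 'rV[K]_(3 + 3)) (A : 'M[K]_(3 + 3)) (D :
  'M[K]_3).
Implicit Types (h : 'M[K]_(3 + 3, 3)) (x : T3).

Local Notation phi := (phiB (net s)).
Local Notation gm := (gmul (net s)).

Lemma phiE u w y : phi u w *m y^T = u *m net s y *m w^T.
Proof.
apply/rowP=> j; rewrite !ord1 {j}.
rewrite [y in net s y]row_sum_delta linear_sum /= mulmx_sumr mulmx_suml summxE mxE.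
apply: eq_bigr => k _; rewrite linearZ /= -scalemxAr -scalemxAl.
by rewrite [y^T _ _]mxE [RHS]mxE mulrC; congr (_ * _); rewrite mxE.
Qed.

Lemma row_eq_pairing (v v' : 'rV[K]_3) : (forall y : 'rV[K]_3, v *m y^T = v' *m y^T) ->
  v = v'.
Proof.
move=> E; apply/rowP=> j; have := E (delta_mx 0 j).
by rewrite trmx_delta -!colE => /rowP/(_ 0); rewrite !mxE.
Qed.

(** The commutator map of the group, on the coordinates z = (u, w) modulo the centre. *)
Definition om z z' := phi (lsubmx z) (rsubmx z') - phi (lsubmx z') (rsubmx z).

Lemma phi0r u : phi u 0 = 0.
Proof. by apply/rowP=> k; rewrite [LHS]mxE trmx0 mulmx0 !mxE. Qed.

Lemma omE z z' y : om z z' *m y^T = z *m altnet s y *m z'^T.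
Proof.
rewrite /om mulmxBl !phiE -[in RHS](hsubmxK z) -[in RHS](hsubmxK z') /altnet
  mul_row_block.
rewrite !mulmx0 add0r addr0 tr_row_mx mul_row_col mulmxN mulNmx [RHS]addrC; congr (_ -
  _).
have tr11 (M : 'M[K]_1) : M^T = M by apply/rowP=> j; rewrite mxE !ord1.
by rewrite -[LHS]tr11 !trmx_mul trmxK net_sym mulmxA.
Qed.

Lemma bilinear_ext n (M M' : 'M[K]_n) :
  (forall z z' : 'rV[K]_n, z *m M *m z'^T = z *m M' *m z'^T) -> M = M'.
Proof.
move=> E; apply/matrixP=> a b; have := E (delta_mx 0 a) (delta_mx 0 b).
by rewrite trmx_delta -!rowE -!colE => /rowP/(_ 0); rewrite !mxE.
Qed.

(** The parameter y is a linear form on the centre, so it is moved by the transpose of D. *)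
Lemma om_isometryP A D :
  (forall y, A *m altnet s y *m A^T = altnet s (y *m D^T)) <->
  (forall z z', om (z *m A) (z' *m A) = om z z' *m D).
Proof.
have key z z' y : om z z' *m D *m y^T = z *m altnet s (y *m D^T) *m z'^T.
  by rewrite -mulmxA -[D]trmxK -trmx_mul omE trmxK.
split=> [E z z'|E y].
  apply: row_eq_pairing => y; rewrite key -E omE trmx_mul !mulmxA.
  by [].
apply: bilinear_ext => z z'.
by rewrite -key -E omE trmx_mul !mulmxA.
Qed.

Definition zpart x : 'rV[K]_(3 + 3) := row_mx x.1.1 x.1.2.

(* In the coordinate t - phi(u, w) / 2 the group law is z + z', t + t' + [z, z'] / 2,
   so that (A, D) acts linearly; the quadratic term translates this back. *)
Definition autf A D h x : T3 :=
  let z := zpart x *m A in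
  (lsubmx z, rsubmx z, x.2 *m D + zpart x *m h +
    2^-1 *: (phi (lsubmx z) (rsubmx z) - phi x.1.1 x.1.2 *m D)).

Lemma zpart_mul x x' : zpart (gm x x') = zpart x + zpart x'.
Proof. by rewrite /zpart /= add_row_mx. Qed.

Lemma autf_mul A D h : (forall z z', om (z *m A) (z' *m A) = om z z' *m D) ->
  {morph autf A D h : x x' / gm x x'}.
Proof.
move=> E x x'; rewrite /autf /= zpart_mul !mulmxDl !linearD /=.
congr (_, _, _).
have := E (zpart x) (zpart x'); rewrite /om !row_mxKl !row_mxKr mulmxBl.
rewrite !(phiBDl, phiBDr) !mulmxDl.
set a := lsubmx (zpart x *m A); set b := rsubmx (zpart x *m A).
set a' := lsubmx (zpart x' *m A); set b' := rsubmx (zpart x' *m A).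
move: (phi a b) (phi a b') (phi a' b) (phi a' b') => P Q R S.
move: (phi x.1.1 x.1.2 *m D) (phi x.1.1 x'.1.2 *m D) (phi x'.1.1 x.1.2 *m D)
  (phi x'.1.1 x'.1.2 *m D) => p q r t.
move: (x.2 *m D) (x'.2 *m D) (zpart x *m h) (zpart x' *m h) => t1 t2 v1 v2.
move=> EQR; apply/rowP=> j; move/rowP/(_ j): EQR; rewrite !mxE => EQR.
have -> : Q 0 j = R 0 j + q 0 j - r 0 j by apply: (lincomb (eq_subr0 EQR)); ring.
by field.
Qed.

Lemma autf_inj A D h : A \in unitmx -> D \in unitmx -> injective (autf A D h).
Proof.
move=> uA uD [[u w] t] [[u' w'] t'] [el er].
have : zpart (u, w, t) *m A = zpart (u', w', t') *m A.
  by rewrite -[LHS]hsubmxK -[RHS]hsubmxK el er.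
move/(can_inj (mulmxK uA)) => ez; rewrite ez /=.
case/eq_row_mx: ez => /= -> -> /addIr/addIr/(can_inj (mulmxK uD)) -> //.
Qed.

Lemma autf_param_inj A D h A' D' h' :
  autf A D h =1 autf A' D' h' -> [/\ A = A', D = D' & h = h'].
Proof.
move=> E.
have AA' : A = A'.
  apply/row_matrixP=> k; rewrite !rowE; set z := delta_mx 0 k.
  have [el er _] := E (lsubmx z, rsubmx z, 0).
  by move: el er; rewrite /zpart /= hsubmxK => el er; rewrite -[LHS]hsubmxK
    -[RHS]hsubmxK el er.
have DD' : D = D'.
  apply/row_matrixP=> k; rewrite !rowE; have [_ _] := E (0, 0, delta_mx 0 k).
  by rewrite /zpart /= row_mx0 !mul0mx !linear0 phi0r !mul0mx subrr !scaler0 !addr0.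
split=> //; apply/row_matrixP=> k; rewrite !rowE; set z := delta_mx 0 k.
have [_ _] := E (lsubmx z, rsubmx z, 0).
by rewrite /zpart /= hsubmxK AA' DD' => /addIr/addrI.
Qed.

Lemma phi_nondeg u : (forall w, phi u w = 0) -> u = 0.
Proof.
(* The point (1 : 0 : 0) is not on the curve, so the net is invertible there. *)
move=> E; pose N := net s (row3 1 0 0).
have uN : N \in unitmx.
  rewrite unitmxE unitfE det_net // mulf_neq0 ?one_add3_sqr_neq0 //.
  rewrite /cubicv !mxE /= (_ : cubic _ _ _ = 1) ?oner_neq0 // /cubic; ring.
apply: (can_inj (mulmxK uN)); rewrite mul0mx; apply: row_eq_pairing => w.
by rewrite -phiE E !mul0mx.
Qed.

Lemma phi_nondegr w : (forall u, phi u w = 0) -> w = 0.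
Proof.
move=> E; apply: phi_nondeg => u; apply: row_eq_pairing => y.
have tr11 (M : 'M[K]_1) : M^T = M by apply/rowP=> j; rewrite mxE !ord1.
by rewrite phiE -[LHS]tr11 !trmx_mul trmxK net_sym mulmxA -phiE E.
Qed.

(** As f is onto, the image of a central element commutes with everything; nondegeneracy of phi then
    kills its first two components. *)
Lemma morph_center (f f' : T3 -> T3) t : cancel f' f ->
  {morph f : x x' / gm x x'} -> (f (0, 0, t)).1 = (0, 0).
Proof.
move=> fK fM; case E: (f (0, 0, t)) => [[a b] c] /=.
have cen u w : phi a w = phi u b.
  have := fM (0, 0, t) (f' (u, w, 0)); have := fM (f' (u, w, 0)) (0, 0, t).
  have -> : gm (f' (u, w, 0)) (0, 0, t) = gm (0, 0, t) (f' (u, w, 0)).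
    by rewrite /gmul /= phi0r phiB0l !add0r !addr0 addrC.
  move=> ->; by rewrite E fK => -[_ _ /=]; rewrite add0r addr0 => /addrI ->.
have a0 : a = 0 by apply: phi_nondeg => w; rewrite (cen 0) phiB0l.
have b0 : b = 0 by apply: phi_nondegr => u; rewrite -(cen u 0) phi0r.
by rewrite a0 b0.
Qed.

(** Here q1, q2, q3 stand for q(z), q(z'), q(z + z'), where q(z) is the central coordinate of the
    image of (z, 0). Exchanging z and z' leaves q3 unchanged, so it cancels in the difference. *)
Lemma polarization_om (a b a' b' u w u' w' q1 q2 q3 : 'rV[K]_3) D :
    q1 + q2 + phi a b' = q3 + phi u w' *m D ->
    q2 + q1 + phi a' b = q3 + phi u' w *m D ->
  phi a b' - phi a' b = (phi u w' - phi u' w) *m D.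
Proof.
rewrite mulmxBl.
move: (phi u w' *m D) (phi u' w *m D) (phi a b') (phi a' b) => p1 p2 P Q E1 E2.
apply/rowP=> j; move/rowP/(_ j): E1; move/rowP/(_ j): E2; rewrite !mxE => E2 E1.
by apply: (lincomb (lincombD (eq_subr0 E1) (lincombM (-1) (eq_subr0 E2)))); ring.
Qed.

(** Removing from q half of its quadratic part leaves an additive map. *)
Lemma polarization_quad (a b a' b' u w u' w' q1 q2 q3 : 'rV[K]_3) D :
    q1 + q2 + phi a b' = q3 + phi u w' *m D ->
    q2 + q1 + phi a' b = q3 + phi u' w *m D ->
  q3 - 2^-1 *: (phi (a + a') (b + b') - phi (u + u') (w + w') *m D) =
  q1 - 2^-1 *: (phi a b - phi u w *m D) + (q2 - 2^-1 *: (phi a' b' - phi u' w' *m D)).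
Proof.
rewrite !(phiBDl, phiBDr) !mulmxDl.
move: (phi a b) (phi a b') (phi a' b) (phi a' b') => P Q R S.
move: (phi u w *m D) (phi u w' *m D) (phi u' w *m D) (phi u' w' *m D) => p1 p2 p3 p4 E1
  E2.
apply/rowP=> j; move/rowP/(_ j): E1; move/rowP/(_ j): E2; rewrite !mxE => E2 E1.
have -> : q3 0 j = q1 0 j + q2 0 j + Q 0 j - p2 0 j.
  by apply: (lincomb (lincombM (-1) (eq_subr0 E1))); ring.
have -> : Q 0 j = R 0 j + p2 0 j - p3 0 j.
  by apply: (lincomb (lincombD (eq_subr0 E1) (lincombM (-1) (eq_subr0 E2)))); ring.
by field.
Qed.

Hypothesis additive_mx : forall m n (f : 'rV[K]_m -> 'rV[K]_n),
  {morph f : x y / x + y} -> {M : 'M[K]_(m, n) | forall v, f v = v *m M}.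

(** The maps induced on G/Z(G) and Z(G) are additive, hence given by matrices A and D. The central
    coordinate of f on the section t = 0 is quadratic up to an additive term, and that term is h. *)
Lemma morph_autf (f f' : T3 -> T3) : cancel f f' -> cancel f' f ->
  {morph f : x x' / gm x x'} ->
  exists A D h, [/\ A \in unitmx,
    forall z z', om (z *m A) (z' *m A) = om z z' *m D & f =1 autf A D h].
Proof.
move=> fK f'K fM.
have f'M : {morph f' : x x' / gm x x'} by move=> x x'; rewrite -[x in LHS]f'K -[x' in
  LHS]f'K -fM fK.
have cen t := morph_center t f'K fM.
have cen' t := morph_center t fK f'M.
have lD (z z' : 'rV[K]_(3 + 3)) : lsubmx (z + z') = lsubmx z + lsubmx z' by exact:
  linearD.
have rD (z z' : 'rV[K]_(3 + 3)) : rsubmx (z + z') = rsubmx z + rsubmx z' by exact: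
  linearD.
pose lift z : T3 := (lsubmx z, rsubmx z, 0).
have liftM z z' : gm (lift z) (lift z') = gm (lift (z + z')) (0, 0, phi (lsubmx z)
  (rsubmx z')).
  by rewrite /gmul /= !linearD /= phi0r !addr0 !add0r.
have fl z z' : gm (f (lift z)) (f (lift z')) =
    gm (f (lift (z + z'))) (f (0, 0, phi (lsubmx z) (rsubmx z'))).
  by rewrite -!fM liftM.
pose al z := zpart (f (lift z)).
have alD : {morph al : z z' / z + z'}.
  move=> z z'; rewrite /al -zpart_mul fl zpart_mul [zpart (f (0, 0, _))]/zpart cen /=.
  by rewrite row_mx0 addr0.
have [A alE] := additive_mx alD.
pose de t := (f (0, 0, t)).2.
have deD : {morph de : t t' / t + t'}.
  move=> t t'; rewrite {1}/de; have -> : f (0, 0, t + t') = gm (f (0, 0, t)) (f (0, 0,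
    t')).
    by rewrite -fM /gmul /= phi0r !addr0.
  by rewrite /gmul /= cen phiB0l addr0.
have [D deE] := additive_mx deD.
pose q z := (f (lift z)).2.
have qE z z' : q z + q z' + phi (lsubmx (z *m A)) (rsubmx (z' *m A)) =
   q (z + z') + phi (lsubmx z) (rsubmx z') *m D.
  have := congr1 snd (fl z z'); rewrite /gmul /= cen phi0r addr0 -/(de _) deE -!/(q _)
    => <-.
  by rewrite -!alE /al /zpart row_mxKl row_mxKr.
have omE' z z' : om (z *m A) (z' *m A) = om z z' *m D.
  have E2 := qE z' z; rewrite [z' + z]addrC in E2.
  exact: polarization_om (qE z z') E2.
pose hf z := q z - 2^-1 *: (phi (lsubmx (z *m A)) (rsubmx (z *m A)) - phi (lsubmx z)
  (rsubmx z) *m D).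
have hfD : {morph hf : z z' / z + z'}.
  move=> z z'; have E2 := qE z' z; rewrite [z' + z]addrC in E2.
  have := polarization_quad (qE z z') E2.
  by rewrite -!lD -!rD -mulmxDl.
have [h hE] := additive_mx hfD.
have liftE u w t : (u, w, t) = gm (lift (row_mx u w)) (0, 0, t).
  by rewrite /gmul /= row_mxKl row_mxKr phi0r !addr0 add0r.
have fE : f =1 autf A D h.
  move=> [[u w] t]; rewrite {1}liftE fM /gmul cen /= !addr0 phi0r addr0 -/(de t) deE
    -/(q _).
  have -> : (f (lift (row_mx u w))).1.1 = lsubmx (row_mx u w *m A).
    by rewrite -alE /al /zpart row_mxKl.
  have -> : (f (lift (row_mx u w))).1.2 = rsubmx (row_mx u w *m A).
    by rewrite -alE /al /zpart row_mxKr.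
  rewrite /autf /zpart /= -hE /hf row_mxKl row_mxKr; congr (_, _, _).
  by rewrite -addrA subrK addrC.
exists A, D, h; split=> //.
(* If z A = 0, then f sends the lift of z into the centre; so does the inverse map with its image,
   whence z = 0. *)
rewrite -row_free_unit; apply: inj_row_free => z; rewrite -alE => al0.
have fl0 : f (lift z) = (0, 0, q z).
  rewrite /q; move: al0; rewrite /al /zpart; case: (f (lift z)) => [[a b] c] /=.
  by rewrite -row_mx0 => /eq_row_mx[-> ->].
have := cen' (q z); rewrite -fl0 fK /lift /= => -[l0 r0].
by rewrite -[z]hsubmxK l0 r0 row_mx0.
Qed.

End Aut.

(** * Additive maps over a prime field *)

Section PrimeField.
Variable p : nat.
Local Notation K := 'F_p.

Lemma Fp_additive_mx m n (f : 'rV[K]_m -> 'rV[K]_n) :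
  {morph f : x y / x + y} -> {M : 'M[K]_(m, n) | forall v, f v = v *m M}.
Proof.
move=> fD; have f0 : f 0 = 0 by apply: (addrI (f 0)); rewrite -fD !addr0.
have fMn v k : f (v *+ k) = f v *+ k.
  by elim: k => [|k IH]; rewrite ?mulr0n // !mulrS fD IH.
have fZ (c : K) v : f (c *: v) = c *: f v by rewrite -[c]natr_Zp !scaler_nat fMn.
exists (\matrix_k f (delta_mx 0 k)) => v.
rewrite {1}[v]row_sum_delta mulmx_sum_row (big_morph f fD f0).
by apply: eq_bigr => k _; rewrite fZ rowK.
Qed.

End PrimeField.

(** * Parameters of an automorphism *)

Section Param.
Variables (K : fieldType) (s : K).
Hypotheses (two_neq0 : (2 : K) != 0) (s3 : s ^+ 3 = s).
Let T3 := ('rV[K]_3 * 'rV[K]_3 * 'rV[K]_3)%type.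
Implicit Types (g : 'M[K]_2) (E T : 'M[K]_3) (c z : K) (P : option (K * K)).
Local Notation gm := (gmul (net s)).

(* At y = (0, 1, 0) the net has the entry -1 in position (0, 1), so this recovers the
   ratio c of a similitude. *)
Definition sim_ratio E := - (E *m net s (row3 0 1 0 *m E) *m E^T) 0 1.
(** The action on the centre forced by g (x) E^-1: g contributes det g, while E^-1 acts on the net
    as y E divided by the ratio of E. *)
Definition center_mx g E := (\det g / sim_ratio E) *: E^T.

Lemma sim_ratioE E c : similitude s E c -> sim_ratio E = c.
Proof. by move=> h; rewrite /sim_ratio h netE mx33_scale !mxE /=; ring. Qed.

Lemma invmx_net E c y : E \in unitmx -> c != 0 -> similitude s E c ->
  invmx E *m net s y *m (invmx E)^T = c^-1 *: net s (y *m E).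
Proof.
move=> uE c0 h; apply: (scalerI c0); rewrite scalerA mulfV // scale1r.
rewrite scalemxAl scalemxAr -h !mulmxA mulVmx // mul1mx.
by rewrite -mulmxA -trmx_mul mulVmx // trmx1 mulmx1.
Qed.

Lemma altnet_tens_similitude g E c y : E \in unitmx -> c != 0 -> similitude s E c ->
  tens g (invmx E) *m altnet s y *m (tens g (invmx E))^T = altnet s (y *m (center_mx g
    E)^T).
Proof.
move=> uE c0 h; rewrite altnet_tens (invmx_net _ uE c0 h) /center_mx (sim_ratioE h).
have -> : (\det g / c *: E^T)^T = (\det g / c) *: E by rewrite linearZ /= trmxK.
by rewrite /altnet scalerA -scalemxAr [net s (_ *: _)]linearZ.
Qed.

Lemma unitmx2_entry g : g \in unitmx -> exists i j, g i j != 0.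
Proof.
move=> ug; apply/matrix0Pn; apply: contraTneq ug => ->.
by rewrite unitmxE det0 unitr0.
Qed.

Lemma invmxZ_unit E c : E \in unitmx -> c != 0 -> invmx (c *: E) = c^-1 *: invmx E.
Proof. by move=> uE c0; rewrite invmxZ // unitmxZ // unitfE. Qed.

Lemma tens_eq g T g' T' : tens g T = tens g' T' -> forall i j, g i j *: T = g' i j *:
  T'.
Proof.
case/eq_block_mx=> E00 E01 E10 E11 [[|[|i]] Hi] // [[|[|j]] Hj] //.
- by move: E00; congr (_ *: _ = _ *: _); congr (_ _ _); apply: val_inj.
- by move: E01; congr (_ *: _ = _ *: _); congr (_ _ _); apply: val_inj.
- by move: E10; congr (_ *: _ = _ *: _); congr (_ _ _); apply: val_inj.
- by move: E11; congr (_ *: _ = _ *: _); congr (_ _ _); apply: val_inj.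
Qed.

(** A tensor determines its factors only up to a scalar and its inverse; normal forms of distinct
    symmetries are never proportional, which removes this freedom. *)
Lemma tens_sym_mx_inj g g' P P' z z' : g \in unitmx ->
    flex P -> z ^+ 4 = 1 -> flex P' -> z' ^+ 4 = 1 ->
  tens g (invmx (sym_mx P z)) = tens g' (invmx (sym_mx P' z')) -> [/\ g = g', P = P' &
    z = z'].
Proof.
move=> ug fP z4 fP' z'4 /tens_eq E.
have uS := sym_mx_unit two_neq0 fP z4; have uS' := sym_mx_unit two_neq0 fP' z'4.
have nz (S : 'M[K]_3) : S \in unitmx -> invmx S != 0.
  rewrite -unitmx_inv => uS1; apply: contraTneq uS1 => ->.
  by rewrite unitmxE det0 unitr0.
have [i [j gij]] := unitmx2_entry ug.
have g'ij : g' i j != 0.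
  apply: contraTneq (nz _ uS) => g'0; have := E i j; rewrite g'0 scale0r => /eqP.
  by rewrite scaler_eq0 (negPf gij) /= => /eqP->; rewrite eqxx.
have ES : sym_mx P z = (g i j / g' i j) *: sym_mx P' z'.
  have := congr1 invmx (E i j); rewrite !invmxZ_unit ?unitmx_inv // !invmxK.
  move/(congr1 (fun M => g i j *: M)); rewrite !scalerA mulfV // scale1r.
  by [].
have [PP' zz'] := sym_mx_inj two_neq0 fP z4 fP' z'4 ES.
split=> //; apply/matrixP=> a b; have := E a b; rewrite -PP' -zz' => /eqP.
by rewrite -subr_eq0 -scalerBl scaler_eq0 (negPf (nz _ uS)) orbF subr_eq0 => /eqP.
Qed.

Hypothesis sqr1 : 3 = 0 :> K -> forall z : K, z ^+ 4 = 1 -> z ^+ 2 = 1.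
Hypothesis additive_mx : forall m n (f : 'rV[K]_m -> 'rV[K]_n),
  {morph f : x y / x + y} -> {M : 'M[K]_(m, n) | forall v, f v = v *m M}.

Definition aut_of (h : 'M[K]_(3 + 3, 3)) g P z :=
  autf s (tens g (invmx (sym_mx P z))) (center_mx g (sym_mx P z)) h.

Lemma morph_aut_of (f f' : T3 -> T3) : cancel f f' -> cancel f' f ->
  {morph f : x x' / gm x x'} ->
  exists h g P z, [/\ g \in unitmx, flex P, z ^+ 4 = 1 /\ z ^+ 2 * s = s & f =1 aut_of
    h g P z].
Proof.
move=> fK f'K fM.
have [A [D [h [uA isoA fE]]]] := morph_autf two_neq0 s3 additive_mx fK f'K fM.
move/(om_isometryP s) in isoA.
have [g [T [AE ug uT]]] := altnet_isometry_tens two_neq0 s3 uA isoA.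
have dg0 : \det g != 0 by move: ug; rewrite unitmxE unitfE.
have simT y : \det g *: (T *m net s y *m T^T) = net s (y *m D^T).
  by have := isoA y; rewrite AE altnet_tens => /eq_block_mx[].
have [|P [z [l [fP z4 zs l0 TE]]]] := @net_sim_class K two_neq0 s T ((\det g)^-1 *:
  D^T) s3 sqr1 uT.
  by move=> y; rewrite -scalemxAr linearZ /= -simT scalerA mulVf // scale1r.
have uS := sym_mx_unit two_neq0 fP z4.
have [c c0 simE] := sym_mx_similitude two_neq0 fP z4 zs.
(* The scalar l is moved from T into g. *)
have AE' : A = tens (l *: g) (invmx (sym_mx P z)).
  by rewrite AE TE /tens !mxE !scalerA ![_ * l]mulrC.
exists h, (l *: g), P, z; split=> //; first by rewrite unitmxZ // unitfE.
suff DE : D = center_mx (l *: g) (sym_mx P z) by move=> x; rewrite fE /aut_of -AE' -DE.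
apply: trmx_inj; apply/row_matrixP=> k; rewrite !rowE.
apply: (altnet_inj two_neq0 (s := s)).
by rewrite -(altnet_tens_similitude _ _ uS c0 simE) -AE' isoA.
Qed.

Lemma aut_of_morph h g P z : flex P -> z ^+ 4 = 1 -> z ^+ 2 * s = s ->
  {morph aut_of h g P z : x x' / gm x x'}.
Proof.
move=> fP z4 zs; apply: autf_mul => //; apply/om_isometryP => y.
have [c c0 simE] := sym_mx_similitude two_neq0 fP z4 zs.
by rewrite (altnet_tens_similitude _ _ (sym_mx_unit two_neq0 fP z4) c0 simE).
Qed.

Lemma tens_unit g T : g \in unitmx -> T \in unitmx -> tens g T \in unitmx.
Proof.
move=> ug uT; have : tens g T *m tens (invmx g) (invmx T) = 1%:M.
  have e i j : g i 0 * invmx g 0 j + g i 1 * invmx g 1 j = (i == j)%:R.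
    have := mulmxV ug => /matrixP/(_ i j); rewrite !mxE => <-.
    rewrite !big_ord_recl big_ord0 addr0.
    by congr (_ _ _ * invmx g _ _ + g _ _ * invmx g _ _); apply: val_inj.
  rewrite /tens mulmx_block -!scalemxAl -!scalemxAr !scalerA mulmxV // -!scalerDl !e.
  by rewrite !scalemx1 [RHS](@scalar_mx_block _ 3 3 1) /= !raddf0.
by case/mulmx1_unit.
Qed.

Lemma aut_of_inj h g P z : g \in unitmx -> flex P -> z ^+ 4 = 1 -> z ^+ 2 * s = s ->
  injective (aut_of h g P z).
Proof.
move=> ug fP z4 zs; have uS := sym_mx_unit two_neq0 fP z4.
have [c c0 simE] := sym_mx_similitude two_neq0 fP z4 zs.
apply: autf_inj; first by rewrite tens_unit ?unitmx_inv.
rewrite unitmxZ ?unitmx_tr // unitfE (sim_ratioE simE) mulf_neq0 ?invr_neq0 //.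
by move: ug; rewrite unitmxE unitfE.
Qed.

End Param.

(** * Counting *)

(** The identity is a dummy value; the parameters counted below always give an injective map. *)
Definition perm_or_id (T : finType) (f : T -> T) : {perm T} :=
  if @injectiveP T T f is ReflectT inj then perm inj else 1%g.

Lemma perm_or_idE (T : finType) (f : T -> T) : injective f -> perm_or_id f =1 f.
Proof. by move=> inj x; rewrite /perm_or_id; case: injectiveP => // i; rewrite permE.
  Qed.

Section Count.
Variables (K : finFieldType) (s : K).
Hypotheses (two_neq0 : (2 : K) != 0) (s3 : s ^+ 3 = s).
Let T3 : finType := ('rV[K]_3 * 'rV[K]_3 * 'rV[K]_3)%type.
Local Notation gm := (gmul (net s)).
Hypothesis sqr1 : 3 = 0 :> K -> forall z : K, z ^+ 4 = 1 -> z ^+ 2 = 1.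
Hypothesis additive_mx : forall m n (f : 'rV[K]_m -> 'rV[K]_n),
  {morph f : x y / x + y} -> {M : 'M[K]_(m, n) | forall v, f v = v *m M}.

Lemma card_morph_perm :
  #|[set a : {perm T3} | [forall x, forall y, a (gm x y) == gm (a x) (a y)]]| =
  (#|K| ^ 18 * #|'GL_2[K]%g| * (#|[set P : option (K * K) | flex P]| *
     #|[set z : K | ((z ^+ 4 == 1) && (z ^+ 2 * s == s))%R]|))%N.
Proof.
(* This factor counts the homomorphisms h from G/Z(G) to Z(G). *)
have -> : (#|K| ^ 18)%N = #|[set: 'M[K]_(3 + 3, 3)]| by rewrite cardsT card_mx.
rewrite -!cardsX; set S := setX _ _.
pose F (q : 'M[K]_(3 + 3, 3) * {'GL_2[K]} * (option (K * K) * K)) : {perm T3} :=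
  perm_or_id (aut_of s q.1.1 (GLval q.1.2) q.2.1 q.2.2 : T3 -> T3).
have SP q : q \in S -> [/\ flex q.2.1, q.2.2 ^+ 4 = 1 & q.2.2 ^+ 2 * s = s].
  by rewrite !inE /= => /and3P[-> /eqP -> /eqP ->].
have GLU (u : {'GL_2[K]}) : GLval u \in unitmx by case: u.
have FE q : q \in S -> F q =1 aut_of s q.1.1 (GLval q.1.2) q.2.1 q.2.2.
  case/SP=> fP z4 zs; apply: perm_or_idE; apply: aut_of_inj => //.
rewrite -(card_in_imset (f := F) (D := mem S)); last first.
  move=> q q' Sq Sq' EF; have [fP z4 _] := SP _ Sq; have [fP' z'4 _] := SP _ Sq'.
  have /autf_param_inj[EA _ Eh] : aut_of s q.1.1 (GLval q.1.2) q.2.1 q.2.2 =1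
      aut_of s q'.1.1 (GLval q'.1.2) q'.2.1 q'.2.2.
    by move=> x; rewrite -FE // EF FE.
  have [Eg EP Ez] := tens_sym_mx_inj two_neq0 (GLU _) fP z4 fP' z'4 EA.
  case: q q' {Sq Sq' EF fP z4 fP' z'4 EA} Eh Eg EP Ez => [[h g] [P z]] [[h' g'] [P'
    z']] /=.
  by move=> -> Eg -> ->; congr (_, _, _); apply: val_inj; move: Eg; case: (g) (g') =>
    [A ?] [B ?].
apply: eq_card => a; apply/idP/imsetP => [|[q Sq ->]]; last first.
  rewrite inE; apply/forallP=> x; apply/forallP=> y.
  by have [fP z4 zs] := SP _ Sq; rewrite !FE // aut_of_morph.
rewrite inE => /forallP morph_a.
have aM : {morph a : x y / gm x y} by move=> x y; apply/eqP/(forallP (morph_a x)).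
have [h [g [P [z [ug fP [z4 zs] aE]]]]] :=
  morph_aut_of two_neq0 s3 sqr1 additive_mx (permK a) (permKV a) aM.
have Sq : ((h, (FinRing.Unit ug : {'GL_2[K]})), (P, z)) \in S.
  by rewrite !inE /= fP z4 zs !eqxx.
by exists (h, (FinRing.Unit ug : {'GL_2[K]}), (P, z)) => //; apply/permP=> x; rewrite
  FE // aE.
Qed.

(** The multiplicative group is cyclic of order q - 1. By Bezout the n-th roots of unity are the
    d-th roots, that is, the powers of an element v of order d. *)
Lemma card_unity_roots n : (0 < n)%N ->
  #|[set z : K | (z ^+ n == 1)%R]| = gcdn #|K|.-1 n.
Proof.
move=> n0; set d := gcdn _ _.
have q1 : (1 < #|K|)%N by exact: finRing_gt1.
have q0 : (0 < #|K|.-1)%N by rewrite -subn1 subn_gt0.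
have d0 : (0 < d)%N by rewrite gcdn_gt0 q0.
have fermat (z : K) : z != 0 -> z ^+ #|K|.-1 = 1.
  move=> z0; apply: (mulfI z0); rewrite -exprS prednK ?expf_card ?mulr1 //.
  exact: ltnW.
have : has #|K|.-1.-primitive_root (enum [pred z : K | z != 0]).
  apply: has_prim_root => //; last 1 first.
  - rewrite -cardE; have := cardC1 (0 : K) => <-; exact: leqnn.
  - by apply/allP=> z; rewrite mem_enum inE unity_rootE => /fermat ->.
  - exact: enum_uniq.
case/hasP=> w _ prim_w.
have dq : (d %| #|K|.-1)%N by exact: dvdn_gcdl.
have prim_v := dvdn_prim_root prim_w dq; set v := w ^+ _ in prim_v.
rewrite -[RHS]card_ord -(card_imset _ (f := fun k : 'I_d => v ^+ k)); last first.
  move=> k l /eqP; rewrite (eq_prim_root_expr prim_v) !modn_small // => /eqP.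
  exact: val_inj.
apply: eq_card => z; rewrite inE; apply/eqP/imsetP => [zn|[k _ ->]]; last first.
  have /dvdnP[m ->] : (d %| n)%N by exact: dvdn_gcdr.
  by rewrite -exprM mulnA [(_ * d)%N]mulnC exprM (prim_expr_order prim_v) expr1n.
have z0 : z != 0.
  by apply: contraTneq (oner_neq0 K) => z0; rewrite negbK -zn z0 expr0n gtn_eqF.
have [a _ /dvdnP[m dm]] := Bezoutl n q0.
have zd : z ^+ d = 1.
  have: z ^+ (d + a * n) = 1 by rewrite dm mulnC exprM fermat // expr1n.
  by rewrite exprD mulnC exprM zn expr1n mulr1.
by have [k ->] := prim_rootP prim_v zd; exists k.
Qed.

End Count.

Lemma Fp_neq0 p n : prime p -> ~~ (p %| n)%N -> (n%:R : 'F_p) != 0.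
Proof. by move=> p_pr; rewrite (dvdn_pcharf (pchar_Fp p_pr)). Qed.

(** Here p = 3, and z^3 = z gives z^4 = z^2. The field of 9 elements would not do. *)
Lemma Fp3_sq p : prime p -> 3 = 0 :> 'F_p -> forall z : 'F_p, z ^+ 4 = 1 -> z ^+ 2 = 1.
Proof.
move=> p_pr t0 z z4.
have p3 : p = 3.
  apply/eqP; rewrite -(dvdn_prime2 p_pr) // (dvdn_pcharf (pchar_Fp p_pr)).
  exact/eqP.
have Fp_card : #|'F_p| = 3 by rewrite card_Fp.
have zp : z ^+ 3 = z by have := expf_card z; rewrite Fp_card.
by rewrite -z4 [RHS]exprS zp expr2.
Qed.

Lemma gmul_net (K : fieldType) i (x y : 'rV[K]_3 * 'rV[K]_3 * 'rV[K]_3) : (1 <= i <=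
  3)%N ->
  gmul (@Bi1 i K) x y = gmul (net (netpar K i)) x y.
Proof.
move=> i13; rewrite /gmul; congr (_, _, _ + _).
by apply/rowP=> k; rewrite !mxE /Bcoef Bi1_net.
Qed.

Lemma card_Aut_G_i1 p i : (1 <= i <= 3)%N ->
  #|Aut [set: G_i1 p i]| =
  #|[set a : {perm ('rV['F_p]_3 * 'rV['F_p]_3 * 'rV['F_p]_3)%type} |
      [forall x, forall y, a (gmul (net (netpar 'F_p i)) x y)
                        == gmul (net (netpar 'F_p i)) (a x) (a y)]]|.
Proof.
move=> i13; apply: eq_card => a; rewrite !inE; apply/andP/idP => [[_ /morphicP
  aM]|/forallP aM].
  apply/forallP=> x; apply/forallP=> y; apply/eqP.
  have := aM x y; rewrite !inE => /(_ isT isT); rewrite -!gmul_net //.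
split; first by apply/subsetP=> x; rewrite inE.
apply/morphicP=> x y _ _; have /eqP := forallP (aM x) y; rewrite -!gmul_net //.
Qed.

Theorem theorem1p3 (p i : nat) :
  prime p -> odd p -> (1 <= i <= 3)%N ->
  #|Aut [set: G_i1 p i]| =
    (gcdn p.-1 ((4 + i).-1 %/ i) * #|('GL_2(p))%g| * p ^ 18 * #|E1_3 p|)%N.
Proof.
move=> p_pr p_odd i13.
have two_neq0 : (2 : 'F_p) != 0.
  by apply: Fp_neq0 => //; rewrite dvdn_prime2 //; apply: contraTneq p_odd => ->.
rewrite card_Aut_G_i1 // card_morph_perm //; first last.
- exact: Fp_additive_mx.
- exact: Fp3_sq.
- exact: netparX3.
have -> : #|[set P : option ('F_p * 'F_p) | flex P]| = #|E1_3 p|.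
  by apply: eq_card => P; rewrite !inE.
(* The exponent, the ceiling of 4 / i, is 4, 2, 2. For s = 0 the condition z^2 s = s is void; for s
   = 1 or -1 it says z^2 = 1, which implies z^4 = 1. *)
have -> : #|[set z : 'F_p | ((z ^+ 4 == 1) && (z ^+ 2 * netpar 'F_p i == netpar 'F_p
  i))%R]| =
    gcdn p.-1 ((4 + i).-1 %/ i).
  rewrite -[in RHS](card_Fp p_pr) -card_unity_roots.
    apply: eq_card => z; rewrite !inE.
    case: i i13 => [|[|[|[|i]]]] //= _.
    - by rewrite mulr0 eqxx andbT.
    - rewrite mulr1; apply: andb_idl => /eqP z2.
      by rewrite (exprM z 2 2) z2 expr1n.
    - rewrite mulrN1 eqr_opp; apply: andb_idl => /eqP z2.
      by rewrite (exprM z 2 2) z2 expr1n.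
  by case: i i13 => [|[|[|[|i]]]].
rewrite card_Fp //; ring.
Qed.
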